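(* Let $s\in(0,1)$, $h\in C^2(\mathbb{R})$ and $\epsilon\in(0,1)$. Then there exist $\delta_1,\delta_2\in\left[0,\frac{\epsilon}{2}\right]$ and $v\in C^2( (-1-\epsilon,1+\epsilon))\cap C(\mathbb{R})$ such that all of the following hold: $$\|v-h\|_{C^2 ((-1,1))}\le\epsilon;$$ $$(-\partial^2_x)^s v(x):= \mathrm{p.v.}\int_{\mathbb{R}} \frac{v(x)-v(y)}{|x-y|^{1+2s}}\,dy=0 \quad\text{for any } x\in(-1-\delta_1,1+\delta_2);$$ $$(\partial_\nu)^s v(x)= \lim_{\substack{ y\in (-1-\delta_1,1+\delta_2)\\ y\to x}} \frac{v(x)-v(y)}{|x-y|^s}=0 \quad\text{for any } x\in\{-1-\delta_1,1+\delta_2\};$$ $$v'(-1-\delta_1)=v'(1+\delta_2)=0;$$ and $v$ has bounded support.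
   Context: $\mathrm{p.v.}$ denotes the Cauchy principal value of the integral at $y=x$. The operator $(-\partial_x^2)^s$ is the one-dimensional integral fractional Laplacian (up to a normalizing constant), and $(\partial_\nu)^s$ denotes the fractional boundary derivative given by the displayed limit. *)

(* Defs.v *)
From mathcomp Require Import all_boot all_order all_algebra.
From mathcomp Require Import all_classical all_reals all_analysis.

Set Implicit Arguments.
Unset Strict Implicit.
Unset Printing Implicit Defensive.

Import Order.TTheory GRing.Theory Num.Theory.
Import numFieldNormedType.Exports.

Local Open Scope classical_set_scope.
Local Open Scope ring_scope.

(* Membership in C^k(D), meant for open D: derivatives are two-sided. *)
Definition classC {R : realType} (k : nat) (D : set R) (f : R -> R) : Prop :=
  forall x, D x ->
    (forall i, (i < k)%N -> derivable f^`(i)%classic x 1) /\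
    (forall i, (i <= k)%N -> {for x, continuous f^`(i)%classic}).

(* The C^k(D)-norm of f, as the sum of the sup norms of its derivatives up to
   order k; extended-real valued, so that an unbounded derivative gives +oo. *)
Definition normC {R : realType} (k : nat) (D : set R) (f : R -> R) : \bar R :=
  (\sum_(i < k.+1) ereal_sup [set (`|f^`(i)%classic x|)%:E | x in D])%E.

(* p.v. \int_R g = l, with the singularity at x.  Integrability away from x is
   required because Rintegral returns a junk value on non-integrable functions. *)
Definition pv_integral_eq {R : realType} (g : R -> R) (x l : R) : Prop :=
  (forall r : R, 0 < r ->
     (@lebesgue_measure R).-integrable (~` ball x r) (EFin \o g)) /\
  (\int[@lebesgue_measure R]_(y in ~` ball x r) g y) @[r --> 0^'+] --> l.

(* (-d^2/dx^2)^s v (x) = l, without a normalizing constant. *)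
Definition frac_laplacian_eq {R : realType} (s : R) (v : R -> R) (x l : R) :
    Prop :=
  pv_integral_eq (fun y => (v x - v y) / `|x - y| `^ (1 + 2 * s)) x l.

(* (d_nu)^s v (x) = l at a boundary point x of D, the limit being taken from
   inside D. *)
Definition frac_normal_derivative_eq {R : realType} (s : R) (D : set R)
    (v : R -> R) (x l : R) : Prop :=
  ((v x - v y) / `|x - y| `^ s) @[y --> within D (nbhs x)] --> l.

Definition bounded_support {R : realType} (v : R -> R) : Prop :=
  bounded_set (closure [set x | v x != 0]).

(* Main.v *)
Require Import Defs.
From mathcomp Require Import all_boot all_order all_algebra.
From mathcomp Require Import all_classical all_reals all_analysis.
From mathcomp Require Import measurable_realfun ring lra.

Import Order.TTheory GRing.Theory Num.Theory.
Import numFieldNormedType.Exports.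

(** The torsion function T(y) = ((1 + a y)(1 - g y))_+^s of the interval
    (- 1/a, 1/g) has a constant fractional Laplacian on that interval, equal to
    kappa (a g)^s where kappa depends on s only (torsion_laplacian).  Hence a
    combination of torsion functions whose constants add up to 0 is continuous,
    has bounded support, and is exactly s-harmonic on the intersection of the
    intervals.  It remains to see that such combinations are dense in C^2 near
    [-1, 1].

    The constant is computed in the variable t = 1/(y - x).  For a suitable m,
    the values m + R and m - R of t give terms that add up to an exact
    derivative in R, that of the integral of w^s/(1 + w) up to rescaling
    (paired_tails); the truncation symmetric in y - x and the one symmetric in
    t - m differ by a quantity that tends to 0 (reciprocal_tail_shift).

    For the density, the functions (1 + a x)^s with 0 < a <= 1/4 span a dense
    subspace of C^2 of the interval (-2, 2) (C2_density).  It suffices to treat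
    the second derivatives; the successive derivatives of (1 + a x)^(s-2) with
    respect to a yield at a = 0 all the monomials, because no factor
    s - 2 - k vanishes, and Weierstrass' theorem applies.  When g tends to 0,
    the torsion function tends to (1 + a x)^s in C^2, and the constant
    kappa (a g)^s tends to 0, so that a small multiple of one fixed torsion
    function restores the equation exactly (locally_harmonic_density).

    For the endpoints, h is first modified outside [-1, 1] so that its
    derivative takes the values -1 and 1 at distances eps/4 and eps/2 from 1
    and from -1 (turning_points).  The derivative of a C^2-close function v
    then vanishes at a point in between on each side: these are the endpoints
    1 + d2 and -1 - d1.  The function v is smooth there, so its increments are
    O(|x - y|), which is o(|x - y|^s) since s < 1. *)

Local Open Scope classical_set_scope.
Local Open Scope ring_scope.

(** * Calculus on the real line *)

Lemma is_derive_continuous {R : realType} (f : R -> R) (x df : R) :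
  is_derive x 1 f df -> {for x, continuous f}.
Proof. by case=> dfx _; exact/differentiable_continuous/derivable1_diffP. Qed.

Lemma is_derive_powR_comp {R : realType} (g : R -> R) (e x dg : R) : 0 < g x ->
  is_derive x 1 g dg ->
  is_derive x 1 (fun y => g y `^ e) (e * g x `^ (e - 1) * dg).
Proof. by move=> gx0 dgx; exact: (is_derive1_comp (is_derive1_powR e gx0) dgx). Qed.

Lemma is_derive_affine {R : realType} (a b x : R) :
  is_derive x 1 (fun y => a + b * y) b.
Proof. by apply: is_derive_eq; rewrite /GRing.scale /=; ring. Qed.

Lemma is_derive_affine_powR {R : realType} (a e x : R) : 0 < 1 + a * x ->
  is_derive x 1 (fun y => (1 + a * y) `^ e) (e * a * (1 + a * x) `^ (e - 1)).
Proof.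
move=> x0; have d := @is_derive_powR_comp R (fun y => 1 + a * y) e x a x0 (is_derive_affine 1 a x).
by apply: (is_derive_eq d); ring.
Qed.

Lemma le_MVT {R : realType} (f df : R -> R) (M a b : R) : a <= b ->
  (forall z, a <= z <= b -> is_derive z 1 f (df z)) ->
  (forall z, a <= z <= b -> `|df z| <= M) -> `|f b - f a| <= M * (b - a).
Proof.
move=> ab fd dM.
have [|z|c] := @MVT_segment R f df a b ab.
- by move=> z; rewrite in_itv/= => /andP[/ltW az /ltW zb]; apply: fd; rewrite az.
- apply: derivable_within_continuous => {}z; rewrite in_itv/= => zab.
  by case: (fd _ zab).
- rewrite in_itv/= => cab ->.
  by rewrite normrM (ger0_norm (x := b - a)) ?subr_ge0// ler_wpM2r ?subr_ge0// dM.
Qed.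

Lemma le_MVT_norm {R : realType} (f df : R -> R) (M a b x y : R) :
  (forall z, a <= z <= b -> is_derive z 1 f (df z)) ->
  (forall z, a <= z <= b -> `|df z| <= M) -> a <= x <= b -> a <= y <= b ->
  `|f y - f x| <= M * `|y - x|.
Proof.
move=> fd dM; wlog xy : x y / x <= y.
  move=> H xab yab; have [xy|/ltW yx] := leP x y; first exact: H.
  by rewrite distrC (distrC y); exact: H.
move=> /andP[ax xb] /andP[ay yb]; rewrite (ger0_norm (x := y - x)) ?subr_ge0//.
by apply: (@le_MVT _ f df) => // z /andP[xz zy]; [apply: fd|apply: dM]; apply/andP; split; lra.
Qed.

(** Serves to identify two primitives known to agree at one point, without
    computing an integral by substitution. *)
Lemma eq_derive_eq {R : realType} (f g df : R -> R) (a b : R) : a <= b ->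
  (forall z, a <= z <= b -> is_derive z 1 f (df z)) ->
  (forall z, a <= z <= b -> is_derive z 1 g (df z)) -> f a = g a -> f b = g b.
Proof.
move=> ab fd gd fga.
have : `|(f \- g) b - (f \- g) a| <= 0 * (b - a).
  apply: (@le_MVT _ _ (fun=> 0)) => // [z zab|z _]; last by rewrite normr0.
  have ? := fd z zab; have ? := gd z zab.
  by apply: is_derive_eq; rewrite subrr.
rewrite mul0r normr_le0 /= fga subrr subr0 subr_eq0 => /eqP; exact.
Qed.

Lemma le_norm_from0 {R : realType} (f df : R -> R) (r M x : R) :
  (forall z, -r < z < r -> is_derive z 1 f (df z)) ->
  (forall z, -r < z < r -> `|df z| <= M) -> f 0 = 0 -> -r < x < r ->
  `|f x| <= M * `|x|.
Proof.
move=> fd dM f0 /andP[rx xr].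
have [x0|x0] := leP 0 x.
- have := @le_MVT _ f df M 0 x x0; rewrite f0 !subr0 (ger0_norm x0); apply=> z /andP[z0 zx].
  + by apply: fd; apply/andP; split; lra.
  + by apply: dM; apply/andP; split; lra.
- have := @le_MVT _ f df M x 0 (ltW x0); rewrite f0 !sub0r normrN (ltr0_norm x0).
  apply=> z /andP[z0 zx].
  + by apply: fd; apply/andP; split; lra.
  + by apply: dM; apply/andP; split; lra.
Qed.

(** Second-order Taylor bound at a double zero, from two applications of the
    mean value inequality. *)
Lemma le_norm_from0_2 {R : realType} (f df ddf : R -> R) (r M x : R) :
  (forall z, -r < z < r -> is_derive z 1 f (df z)) ->
  (forall z, -r < z < r -> is_derive z 1 df (ddf z)) ->
  (forall z, -r < z < r -> `|ddf z| <= M) -> f 0 = 0 -> df 0 = 0 ->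
  -r < x < r -> `|f x| <= M * x ^+ 2.
Proof.
move=> fd fdd dM f0 df0 xr.
have dfM z : -r < z < r -> `|df z| <= M * `|z|.
  by move=> zr; exact: (@le_norm_from0 _ df ddf r).
have M0 : 0 <= M by rewrite (le_trans _ (dM _ xr)).
have [x0|x0] := leP 0 x.
- have := @le_MVT _ f df (M * x) 0 x x0; rewrite f0 !subr0 -mulrA -expr2.
  case/andP: xr => rx xr.
  apply=> z /andP[z0 zx].
  + by apply: fd; apply/andP; split; lra.
  + rewrite (le_trans (dfM _ _))//; first by apply/andP; split; lra.
    by rewrite ler_wpM2l// ger0_norm.
- have := @le_MVT _ f df (M * - x) x 0 (ltW x0).
  rewrite f0 !sub0r normrN -mulrA -expr2 sqrrN.
  case/andP: xr => rx xr.
  apply=> z /andP[z0 zx].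
  + by apply: fd; apply/andP; split; lra.
  + rewrite (le_trans (dfM _ _))//; first by apply/andP; split; lra.
    by rewrite ler_wpM2l// ler0_norm// lerN2.
Qed.

Lemma continuous_max0_powR {R : realType} (p : R) : 0 < p ->
  continuous (fun t : R => (Num.max 0 t) `^ p).
Proof.
move=> p0 t; have [t0|t0|->] := ltgtP t 0.
- rewrite /continuous_at max_l ?ltW// powR0 ?gt_eqF//.
  have : (fun=> 0 : R) @ t --> (0 : R) by exact: cvg_cst.
  apply: cvg_trans; apply: near_eq_cvg; near=> z.
  by rewrite max_l ?powR0 ?gt_eqF//; near: z; exact: lt_le_nbhsl.
- rewrite /continuous_at max_r ?ltW//.
  have : (fun z : R => z `^ p) z @[z --> t] --> t `^ p.
    exact: is_derive_continuous (is_derive1_powR p t0).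
  apply: cvg_trans; apply: near_eq_cvg; near=> z.
  by rewrite max_r//; near: z; exact: lt_le_nbhsr.
- rewrite /continuous_at maxxx powR0 ?gt_eqF//.
  have /cvgrPdist_lt h := powR_cvg0 p0.
  apply/cvgrPdist_lt => e e0.
  have := h e e0; rewrite near_withinE => /nbhs_ballP[d /= d0 hd].
  near=> z; have [z0|z0] := leP z 0.
    by rewrite powR0 ?gt_eqF// subrr normr0.
  apply: hd => //.
  rewrite /ball/=; near: z; exact: (nbhsx_ballx (0 : R) d d0).
Unshelve. all: by end_near. Qed.

(** * The kernel of the fractional Laplacian *)

(** The quantitative form of t^(-p) -> 0 is what the explicit error estimates
    below consume. *)
Lemma powR_vanish {R : realType} (p e : R) : 0 < p -> 0 < e ->
  exists2 T, 0 < T & forall t, T <= t -> t `^ (- p) <= e.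
Proof.
move=> p0 e0; exists ((e^-1) `^ (p^-1)); first by rewrite powR_gt0 ?invr_gt0.
move=> t Tt; rewrite powRN.
have T0 : 0 < e^-1 `^ p^-1 by rewrite powR_gt0 ?invr_gt0.
have t0 : 0 < t by exact: lt_le_trans Tt.
rewrite -[leRHS]invrK lef_pV2 ?posrE ?powR_gt0 ?invr_gt0//.
have -> : e^-1 = (e^-1 `^ p^-1) `^ p.
  by rewrite -powRrM mulVf ?gt_eqF// powRr1// invr_ge0 ltW.
by rewrite ge0_ler_powR// ?nnegrE// ltW.
Qed.

Lemma powR_cvgy0 {R : realType} (p x : R) : 0 < p ->
  ((t - x) `^ (- p)) @[t --> +oo] --> (0 : R).
Proof.
move=> p0; apply/cvgrPdist_le => e e0.
have [T T0 hT] := powR_vanish _ _ p0 e0.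
near=> t; rewrite sub0r normrN ger0_norm ?powR_ge0//; apply: hT.
by rewrite lerBrDr; near: t; apply: nbhs_pinfty_ge; exact: num_real.
Unshelve. all: by end_near. Qed.

Definition kern {R : realType} (s x y : R) : R := `|x - y| `^ (- (1 + 2 * s)).

Lemma kern_ge0 {R : realType} (s x y : R) : 0 <= kern s x y.
Proof. exact: powR_ge0. Qed.

Lemma kern_right {R : realType} (s x y : R) : x < y -> kern s x y = (y - x) `^ (- (1 + 2 * s)).
Proof. by move=> xy; rewrite /kern distrC ger0_norm// subr_ge0 ltW. Qed.

Lemma kern_left {R : realType} (s x y : R) : y < x -> kern s x y = (x - y) `^ (- (1 + 2 * s)).
Proof. by move=> xy; rewrite /kern ger0_norm// subr_ge0 ltW. Qed.

Lemma continuous_kern {R : realType} (s x y : R) : y != x -> {for y, continuous (kern s x)}.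
Proof.
move=> yx.
have n0 : 0 < `|x - y| by rewrite normr_gt0 subr_eq0 eq_sym.
apply: (@continuous_comp _ _ _ (fun z : R => `|x - z|) (fun t : R => t `^ (- (1 + 2 * s)))).
  apply: continuous_comp; last exact: norm_continuous.
  by apply: continuousB; [exact: cst_continuous | exact: id].
exact: is_derive_continuous (is_derive1_powR _ n0).
Qed.

Lemma measurable_kern {R : realType} (s x : R) : measurable_fun [set: R] (kern s x).
Proof.
apply: (measurableT_comp (measurable_powR _)).
by apply: measurableT_comp => //; exact: measurable_funB.
Qed.

Lemma integral_kern_right {R : realType} (s x r : R) : 0 < s -> 0 < r ->
  (\int[@lebesgue_measure R]_(y in `[(x + r)%R, +oo[) (kern s x y)%:E =
    ((r `^ (- (2 * s)) / (2 * s))%R)%:E)%E.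
Proof.
move=> s0 r0; pose F y := - (2 * s)^-1 * (y - x) `^ (- (2 * s)).
have dF y : x < y -> is_derive y 1 F (kern s x y).
  move=> xy; rewrite kern_right//.
  have y0 : 0 < y - x by rewrite subr_gt0.
  have d1 : is_derive y 1 (fun z : R => z - x) 1.
    by apply: is_derive_eq; rewrite subr0.
  have d2 := @is_derive_powR_comp R _ (- (2 * s)) y 1 y0 d1.
  apply: is_derive_eq; rewrite /GRing.scale /=.
  rewrite (_ : - (2 * s) - 1 = - (1 + 2 * s)); last by ring.
  by field; rewrite gt_eqF.
rewrite (@ge0_continuous_FTC2y _ _ F _ 0).
- by rewrite -EFinB /F sub0r addrAC subrr add0r mulNr opprK mulrC.
- by move=> y _; exact: kern_ge0.
- apply: continuous_in_subspaceT => y; rewrite inE/= in_itv/= andbT => xry.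
  by apply: continuous_kern; rewrite gt_eqF//; lra.
- rewrite -[X in _ --> X](mulr0 (- (2 * s)^-1)); apply: cvgMr.
  by apply: powR_cvgy0; rewrite mulr_gt0.
- move=> y xry; have [] := dF y; [lra|by []].
- apply: cvg_at_right_filter; apply: is_derive_continuous (dF _ _); lra.
- move=> y; rewrite in_itv/= andbT => xry; rewrite derive1E.
  have xy : x < y by lra.
  by have [_ ->] := dF y xy.
Qed.

(** By the reflection y -> - y this is the right-hand integral at - x. *)
Lemma integral_kern_left {R : realType} (s x r : R) : 0 < s -> 0 < r ->
  (\int[@lebesgue_measure R]_(y in `]-oo, (x - r)%R]) (kern s x y)%:E =
    ((r `^ (- (2 * s)) / (2 * s))%R)%:E)%E.
Proof.
move=> s0 r0; rewrite (_ : (x - r = - (- x + r))%R); last by ring.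
rewrite ge0_integration_by_substitutionNy; last 2 first.
- apply: continuous_in_subspaceT => y; rewrite inE/= in_itv/= => xry.
  by apply: continuous_kern; rewrite lt_eqF//; lra.
- by move=> y _; exact: kern_ge0.
rewrite -(integral_kern_right s (- x) r s0 r0); apply: eq_integral => y _.
by rewrite /= /kern -normrN; congr ((`|_| `^ _)%:E); ring.
Qed.

Lemma integrable_kern_right {R : realType} (s x r : R) : 0 < s -> 0 < r ->
  (@lebesgue_measure R).-integrable `[x + r, +oo[ (EFin \o kern s x).
Proof.
move=> s0 r0; apply/integrableP; split.
  by apply/measurable_EFinP; apply: measurable_funS (measurable_kern s x).
under eq_integral do rewrite /= ger0_norm ?kern_ge0//.
by rewrite integral_kern_right// ltry.
Qed.

Lemma integrable_kern_left {R : realType} (s x r : R) : 0 < s -> 0 < r ->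
  (@lebesgue_measure R).-integrable `]-oo, x - r] (EFin \o kern s x).
Proof.
move=> s0 r0; apply/integrableP; split.
  by apply/measurable_EFinP; apply: measurable_funS (measurable_kern s x).
under eq_integral do rewrite /= ger0_norm ?kern_ge0//.
by rewrite integral_kern_left// ltry.
Qed.

Lemma integrable_mul_kern {R : realType} (s x M : R) (v : R -> R)
    (D : set (measurableTypeR R)) :
  measurable D -> continuous v -> (forall y, `|v y| <= M) ->
  (@lebesgue_measure R).-integrable D (EFin \o kern s x) ->
  (@lebesgue_measure R).-integrable D (EFin \o (fun y => v y * kern s x y)).
Proof.
move=> mD cv vM ik; have M0 : 0 <= M by rewrite (le_trans _ (vM 0)).
apply: (le_integrable mD _ _ (integrableZl mD M ik)).
- apply/measurable_EFinP; apply: measurable_funM.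
  + by apply: measurable_funS (continuous_measurable_fun cv).
  + by apply: measurable_funS (measurable_kern s x).
- move=> y _; rewrite /= lee_fin !normrM ler_wpM2r//.
  by rewrite (ger0_norm M0).
Qed.

Lemma setC_ball_itv {R : realType} (x r : R) :
  ~` ball x r = `]-oo, x - r] `|` `[x + r, +oo[.
Proof.
rewrite ball_itv -[LHS]setTI; apply/seteqP; split=> y /=.
  rewrite !in_itv/= andbT => -[_ /negP]; rewrite negb_and -!leNgt => /orP[]; by [left|right].
rewrite !in_itv/= andbT => h; split=> //; apply/negP; rewrite negb_and -!leNgt.
by apply/orP; case: h; [left|right].
Qed.

Lemma disjoint_tails {R : realType} (x r : R) : 0 < r ->
  [disjoint `]-oo, x - r] & `[x + r, +oo[].
Proof. by move=> r0; apply/disj_setPS => y [/=]; rewrite !in_itv/= andbT => h1 h2; lra. Qed.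

Lemma integral_setC_ball {R : realType} (x r : R) (g : R -> R) : 0 < r ->
  (@lebesgue_measure R).-integrable (`]-oo, x - r] `|` `[x + r, +oo[) (EFin \o g) ->
  \int[@lebesgue_measure R]_(y in ~` ball x r) g y =
  \int[@lebesgue_measure R]_(y in `]-oo, x - r]) g y +
  \int[@lebesgue_measure R]_(y in `[x + r, +oo[) g y.
Proof.
by move=> r0 ig; rewrite setC_ball_itv Rintegral_setU//; exact: disjoint_tails.
Qed.

(** * Reduction of the principal value to two tails *)

Lemma integrableU {d : measure_display} {T : measurableType d} {R : realType}
    (mu : {measure set T -> \bar R}) (A B : set T) (f : T -> \bar R) :
  measurable A -> measurable B -> [disjoint A & B] ->
  mu.-integrable A f -> mu.-integrable B f -> mu.-integrable (A `|` B) f.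
Proof.
move=> mA mB AB /integrableP[mfA iA] /integrableP[mfB iB]; apply/integrableP.
have mU : measurable_fun (A `|` B) f by apply/measurable_funU.
split=> //; rewrite ge0_integral_setU//; last exact: measurableT_comp.
exact: lte_add_pinfty.
Qed.

(** The two tails carry the part v(y) of the numerator v(x) - v(y); the part
    v(x) is explicit since the kernel is integrated in closed form. *)
Definition right_tail {R : realType} (s x : R) (v : R -> R) (r : R) : R :=
  \int[@lebesgue_measure R]_(y in `[x + r, +oo[) (v y * kern s x y).

Definition left_tail {R : realType} (s x : R) (v : R -> R) (r : R) : R :=
  \int[@lebesgue_measure R]_(y in `]-oo, x - r]) (v y * kern s x y).

Lemma integrable_right {R : realType} (s x M r : R) (v : R -> R) :
  0 < s -> continuous v -> (forall y, `|v y| <= M) -> 0 < r ->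
  (@lebesgue_measure R).-integrable `[x + r, +oo[ (EFin \o (fun y => v y * kern s x y)).
Proof.
by move=> s0 cv vM r0; apply: integrable_mul_kern cv vM _ => //; exact: integrable_kern_right.
Qed.

Lemma integrable_left {R : realType} (s x M r : R) (v : R -> R) :
  0 < s -> continuous v -> (forall y, `|v y| <= M) -> 0 < r ->
  (@lebesgue_measure R).-integrable `]-oo, x - r] (EFin \o (fun y => v y * kern s x y)).
Proof.
by move=> s0 cv vM r0; apply: integrable_mul_kern cv vM _ => //; exact: integrable_kern_left.
Qed.

Lemma continuous_mul_kern {R : realType} (s x y : R) (v : R -> R) :
  continuous v -> y != x -> {for y, continuous (fun y => v y * kern s x y)}.
Proof. by move=> cv yx; apply: continuousM; [exact: cv|exact: continuous_kern]. Qed.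

(** The integral over the half-line is a constant minus the integral over
    [x + r/2, x + r], to which the fundamental theorem of calculus applies. *)
Lemma is_derive_right_tail {R : realType} (s x M r : R) (v : R -> R) :
  0 < s -> continuous v -> (forall y, `|v y| <= M) -> 0 < r ->
  is_derive r 1 (right_tail s x v) (- (v (x + r) * r `^ (- (1 + 2 * s)))).
Proof.
move=> s0 cv vM r0; pose f y := v y * kern s x y.
pose F y := \int[@lebesgue_measure R]_(t in `[x + r / 2, y]) f t.
have r20 : 0 < r / 2 by lra.
have intf := integrable_right s x M _ v s0 cv vM r20.
have dF : is_derive (x + r) 1 F (f (x + r)).
  have lt1 : x + r < x + r + 1 by lra.
  have i1 : (@lebesgue_measure R).-integrable `[x + r / 2, x + r + 1] (EFin \o f).
    by apply: integrableS intf => //; exact: subset_itvl.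
  have cf : {for x + r, continuous f}.
    by apply: continuous_mul_kern => //; rewrite gt_eqF//; lra.
  have [dF F'] : derivable F (x + r) 1 /\ F^`()%classic (x + r) = f (x + r).
    by apply: (continuous_FTC1_closed lt1 i1) => //; lra.
  by split; [exact: dF|rewrite -derive1E; exact: F'].
have d1 : is_derive r 1 (fun t : R => x + t) 1.
  by apply: (is_derive_eq (is_deriveD (is_derive_cst x r 1) (is_derive_id r 1))); rewrite add0r.
have d2 : is_derive r 1 (fun t : R => F (x + t)) (f (x + r) * 1).
  exact: (@is_derive1_comp R F _ r _ _ dF d1).
have -> : - (v (x + r) * r `^ (- (1 + 2 * s))) = 0 - f (x + r) * 1.
  by rewrite sub0r mulr1 /f kern_right; [congr (- (_ * _ `^ _)); ring|lra].
apply: (@near_eq_is_derive _ _ _ (fun t => right_tail s x v (r / 2) - F (x + t))).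
near=> t; have rt : r / 2 <= t by near: t; apply: lt_le_nbhsr; lra.
rewrite /right_tail /F Rintegral_itvB ?bnd_simp; [|exact: intf| |by []]; last by lra.
rewrite Rintegral_itv_obnd_cbnd//.
apply: (integrableS _ _ _ intf) => // y /=; rewrite !in_itv/= !andbT; lra.
Unshelve. all: by end_near. Qed.

Lemma is_derive_left_tail {R : realType} (s x M r : R) (v : R -> R) :
  0 < s -> continuous v -> (forall y, `|v y| <= M) -> 0 < r ->
  is_derive r 1 (left_tail s x v) (- (v (x - r) * r `^ (- (1 + 2 * s)))).
Proof.
move=> s0 cv vM r0; pose f y := v y * kern s x y.
pose F y := \int[@lebesgue_measure R]_(t in `]-oo, y]) f t.
have r20 : 0 < r / 2 by lra.
have intf := integrable_left s x M _ v s0 cv vM r20.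
have dF : is_derive (x - r) 1 F (f (x - r)).
  have lt1 : x - r < x - r / 2 by lra.
  have cf : {for x - r, continuous f}.
    by apply: continuous_mul_kern => //; rewrite lt_eqF//; lra.
  have [dF F'] : derivable F (x - r) 1 /\ F^`()%classic (x - r) = f (x - r).
    by apply: (continuous_FTC1 lt1 intf) => //; rewrite ltNyr.
  by split; [exact: dF|rewrite -derive1E; exact: F'].
have d1 : is_derive r 1 (fun t : R => x - t) (-1).
  by apply: (is_derive_eq (is_deriveB (is_derive_cst x r 1) (is_derive_id r 1))); rewrite sub0r.
have d2 : is_derive r 1 (fun t : R => F (x - t)) (f (x - r) * -1).
  exact: (@is_derive1_comp R F _ r _ _ dF d1).
apply: (is_derive_eq d2).
by rewrite mulrN1 /f kern_left; [congr (- (_ * _ `^ _)); ring|lra].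
Qed.

Lemma right_tail_eq0 {R : realType} (s x r : R) (v : R -> R) :
  (forall y, x + r <= y -> v y = 0) -> right_tail s x v r = 0.
Proof.
move=> v0; rewrite /right_tail (@eq_Rintegral _ _ _ _ _ (fun=> 0)); first
  by rewrite /Rintegral integral0.
by move=> y; rewrite inE/= in_itv/= andbT => /v0 ->; rewrite mul0r.
Qed.

Lemma left_tail_eq0 {R : realType} (s x r : R) (v : R -> R) :
  (forall y, y <= x - r -> v y = 0) -> left_tail s x v r = 0.
Proof.
move=> v0; rewrite /left_tail (@eq_Rintegral _ _ _ _ _ (fun=> 0)); first
  by rewrite /Rintegral integral0.
by move=> y; rewrite inE/= in_itv/= => /v0 ->; rewrite mul0r.
Qed.

(** Both half-lines contribute v(x) r^(-2s)/(2s) through v(x), hence the term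
    v(x) r^(-2s)/s. *)
Lemma pv_integral_eq_tails {R : realType} (s x M l : R) (v : R -> R) :
  0 < s -> continuous v -> (forall y, `|v y| <= M) ->
  (v x * r `^ (- (2 * s)) / s - left_tail s x v r - right_tail s x v r) @[r --> 0^'+] --> l ->
  frac_laplacian_eq s v x l.
Proof.
move=> s0 cv vM lim.
have gE y : (v x - v y) / `|x - y| `^ (1 + 2 * s) = v x * kern s x y - v y * kern s x y.
  by rewrite -mulrBl /kern powRN.
have int1 (D : set (measurableTypeR R)) : measurable D ->
    (@lebesgue_measure R).-integrable D (EFin \o kern s x) ->
    (@lebesgue_measure R).-integrable D (EFin \o (fun y => v x * kern s x y)) /\
    (@lebesgue_measure R).-integrable D (EFin \o (fun y => v y * kern s x y)).
  move=> mD ik; split.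
    by apply: (@integrable_mul_kern _ s x M (fun=> v x)) => //; exact: cst_continuous.
  exact: integrable_mul_kern vM _.
have iL r : 0 < r -> (@lebesgue_measure R).-integrable `]-oo, x - r]
    (EFin \o fun y => (v x - v y) / `|x - y| `^ (1 + 2 * s)).
  move=> r0; have [i1 i2] := int1 _ (measurable_itv _) (integrable_kern_left s x r s0 r0).
  by apply: eq_integrable (integrableB _ i1 i2) => // y _; rewrite /= gE EFinB.
have iR r : 0 < r -> (@lebesgue_measure R).-integrable `[x + r, +oo[
    (EFin \o fun y => (v x - v y) / `|x - y| `^ (1 + 2 * s)).
  move=> r0; have [i1 i2] := int1 _ (measurable_itv _) (integrable_kern_right s x r s0 r0).
  by apply: eq_integrable (integrableB _ i1 i2) => // y _; rewrite /= gE EFinB.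
have iB r : 0 < r -> (@lebesgue_measure R).-integrable (`]-oo, x - r] `|` `[x + r, +oo[)
    (EFin \o fun y => (v x - v y) / `|x - y| `^ (1 + 2 * s)).
  by move=> r0; apply: integrableU; [exact: measurable_itv|exact: measurable_itv|
    exact: disjoint_tails|exact: iL|exact: iR].
split; first by move=> r r0; rewrite setC_ball_itv; exact: iB.
move: lim; apply: cvg_trans; apply: near_eq_cvg; near=> r.
have r0 : 0 < r by [].
rewrite integral_setC_ball//; last exact: iB.
have [i1 i2] := int1 _ (measurable_itv _) (integrable_kern_left s x r s0 r0).
have [j1 j2] := int1 _ (measurable_itv _) (integrable_kern_right s x r s0 r0).
under eq_Rintegral do rewrite gE.
under [X in _ = _ + X]eq_Rintegral do rewrite gE.
rewrite !RintegralB// !RintegralZl//; last 2 first.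
  exact: integrable_kern_right.
  exact: integrable_kern_left.
rewrite {1 3}/Rintegral integral_kern_left// integral_kern_right//=.
by rewrite /left_tail /right_tail; field; rewrite gt_eqF.
Unshelve. all: by end_near. Qed.

(** * The constant kappa *)

Lemma powR_invl {R : realType} (t a : R) : 0 <= t -> t^-1 `^ a = t `^ (- a).
Proof. by move=> t0; rewrite -powR_inv1// -powRrM mulN1r. Qed.

Lemma powR_le_near1 {R : realType} (w e : R) : 1 / 2 <= w <= 2 -> w `^ e <= 2 `^ `|e|.
Proof.
move=> /andP[w1 w2]; have w0 : 0 < w by lra.
rewrite /powR !gt_eqF// ler_expR.
have lnw : `|ln w| <= ln 2.
  rewrite ler_norml -lnV ?posrE// !ler_ln ?posrE ?invr_gt0// w2 andbT; lra.
apply: le_trans (ler_norm _) _; rewrite normrM ler_wpM2l//.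
Qed.

(** For an exponent in (0, 1), w^s lies between 1 and w. *)
Lemma dist1_powR {R : realType} (s w : R) : 0 < s -> s < 1 -> 0 <= w ->
  `|1 - w `^ s| <= `|1 - w|.
Proof.
move=> s0 s1 w0; have [w1|w1] := leP 1 w.
- have h1 : 1 <= w `^ s by rewrite -(powRr0 w) ler_powR// ltW.
  have h2 : w `^ s <= w by rewrite ler1_powR// ltW.
  by rewrite (@ler0_norm _ (1 - w `^ s)) ?(@ler0_norm _ (1 - w)); lra.
- have [->|w0'] := eqVneq w 0; first by rewrite powR0 ?gt_eqF.
  have w01 : 0 < w <= 1 by rewrite lt_neqAle eq_sym w0' w0 ltW.
  have h1 : w `^ s <= 1 by rewrite -(powRr0 w) ger_powR// ltW.
  have h2 : w <= w `^ s by rewrite ger1_powR// ltW.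
  by rewrite (@ger0_norm _ (1 - w `^ s)) ?(@ger0_norm _ (1 - w)); lra.
Qed.

Lemma le_MVT_sub {R : realType} (f g df dg : R -> R) (a b : R) : a <= b ->
  (forall z, a <= z <= b -> is_derive z 1 f (df z)) ->
  (forall z, a <= z <= b -> is_derive z 1 g (dg z)) ->
  (forall z, a <= z <= b -> df z <= dg z) -> f b - f a <= g b - g a.
Proof.
move=> ab fd gd le_d.
have hd z : a <= z <= b -> is_derive z 1 (g - f) (dg z - df z).
  by move=> zab; have ? := fd z zab; have ? := gd z zab; exact: is_deriveB.
have [z||c cab E] := @MVT_segment R (g - f) (fun z => dg z - df z) a b ab.
- by rewrite in_itv/= => /andP[/ltW az /ltW zb]; apply: hd; rewrite az.
- apply: derivable_within_continuous => z; rewrite in_itv/= => zab.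
  by case: (hd _ zab).
move: cab; rewrite in_itv/= => cab.
have : 0 <= (g b - f b) - (g a - f a).
  have -> : (g b - f b) - (g a - f a) = (g - f) b - (g - f) a by [].
  by rewrite E mulr_ge0// subr_ge0// le_d.
by move=> h; lra.
Qed.

(** G is the integral of w^s/(1 + w) from 0 to X.  The difference X^s/s - G(X)
    has derivative X^(s-1)/(1 + X), which is nonnegative and at most X^(s-2),
    an integrable function at infinity; so it increases to a finite limit,
    namely the integral of w^(s-1)/(1 + w) over (0, +oo). *)
Lemma torsion_constant {R : realType} (s : R) : 0 < s -> s < 1 ->
  exists (kappa : R) (G : R -> R), [/\ G 0 = 0,
    (forall X : R, 0 <= X -> is_derive X 1 G (X `^ s / (1 + X))) &
    X `^ s / s - G X @[X --> +oo%R] --> kappa].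
Proof.
move=> s0 s1; pose g (w : R) := Num.max 0 w `^ s / (1 + Num.max 0 w).
have cg : continuous g.
  move=> w; apply: (@continuousM _ _ (fun w : R => Num.max 0 w `^ s) (fun w
    : R => (1 + Num.max 0 w)^-1)).
    exact: continuous_max0_powR.
  apply: (@continuousV _ _ (fun w : R => 1 + Num.max 0 w)).
    by rewrite gt_eqF// ltr_pwDl// le_max lexx.
  apply: (@continuousD _ _ _ (fun=> 1 : R) (fun w : R => Num.max 0 w)); first exact: cst_continuous.
  apply: (@continuous_max _ _ (fun=> 0) id); [exact: cst_continuous|exact: id].
(* The integration starts at -1 and g vanishes on [-1, 0], so that F is differentiable at 0 as well. *)
pose F (X : R) := \int[@lebesgue_measure R]_(t in `[-1, X]) g t.
have dF (X : R) : 0 <= X -> is_derive X 1 F (X `^ s / (1 + X)).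
  move=> X0; have lt1 : X < X + 1 by lra.
  have i1 : (@lebesgue_measure R).-integrable `[-1, X + 1] (EFin \o g).
    by apply: continuous_compact_integrable; [exact: segment_compact|exact: continuous_subspaceT].
  have [dF F'] : derivable F X 1 /\ F^`()%classic X = g X.
    by apply: (continuous_FTC1_closed lt1 i1); [lra|exact: cg].
  by split; [exact: dF|rewrite -derive1E F' /g max_r].
pose G X := F X - F 0.
have dG (X : R) : 0 <= X -> is_derive X 1 G (X `^ s / (1 + X)).
  move=> X0; have ? := dF X X0.
  by apply: is_derive_eq; rewrite subr0.
pose E X := X `^ s / s - G X.
have dE (X : R) : 1 <= X -> is_derive X 1 E (X `^ (s - 1) / (1 + X)).
  move=> X1; have X0 : 0 < X by lra.
  have d1 := is_derive1_powR s X0; have d2 := dG X (ltW X0).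
  apply: is_derive_eq; rewrite /GRing.scale/=.
  rewrite -(mulr_powRB1 (ltW X0) s0).
  by field; rewrite !gt_eqF//; lra.
have homE (X Y : R) : 1 <= X -> X <= Y -> E X <= E Y.
  move=> X1 XY.
  have := @le_MVT_sub R (fun=> 0) E (fun=> 0) (fun z => z `^ (s - 1) / (1 + z)) X Y XY.
  rewrite subrr subr_ge0; apply.
  - by move=> z /andP[Xz _]; apply: dE; lra.
  - by move=> z /andP[Xz _]; rewrite divr_ge0 ?powR_ge0//; lra.
have bndE (Y : R) : 1 <= Y -> E Y <= E 1 + (1 - s)^-1.
  move=> Y1.
  have := @le_MVT_sub R E (fun X => - (1 - s)^-1 * X `^ (s - 1)) _
    (fun z => z `^ (s - 1 - 1)) 1 Y Y1 (fun z zY => dE z (andP zY).1).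
  have -> : (1 : R) `^ (s - 1) = 1 by rewrite powR1.
  have : 0 <= (1 - s)^-1 * Y `^ (s - 1) by rewrite mulr_ge0 ?powR_ge0// invr_ge0; lra.
  move=> h0 h; have : E Y - E 1 <= - (1 - s)^-1 * Y `^ (s - 1) - - (1 - s)^-1 * 1.
    apply: h => z.
    - move=> /andP[z1 _]; have z0 : 0 < z by lra.
      have d := is_derive1_powR (s - 1) z0; apply: is_derive_eq.
      by rewrite /GRing.scale/=; field; lra.
    - move=> /andP[z1 _]; have z0 : 0 < z by lra.
      rewrite (@powRB _ z (s - 1) 1) ?(gt_eqF z0) ?implybT// powRr1 ?(ltW z0)//.
      by rewrite ler_wpM2l ?powR_ge0// lef_pV2 ?posrE; lra.
  lra.
exists (sup (range (fun X => E (Num.max 1 X)))), G; split => //; first by rewrite /G subrr.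
have : E (Num.max 1 X) @[X --> +oo%R] --> sup (range (fun X => E (Num.max 1 X))).
  apply: nondecreasing_cvgr.
    move=> X Y XY; apply: homE; first by rewrite le_max lexx.
    by rewrite ge_max !le_max lexx XY /= orbT.
  exists (E 1 + (1 - s)^-1) => _ [X _ <-]; apply: bndE; by rewrite le_max lexx.
apply: cvg_trans; apply: near_eq_cvg; near=> X.
rewrite max_r//; near: X; apply: nbhs_pinfty_ge; exact: num_real.
Unshelve. all: by end_near. Qed.

(** * The tails of a torsion function *)

(** In the variable t = 1/r, minus the tail F plus the tail of the constant V,
    whose value is V t^(2s)/(2s): the two singularities at t = +oo cancel. *)
Definition reciprocal_tail {R : realType} (s V : R) (F : R -> R) (t : R) : R :=
  V * t `^ (2 * s) / (2 * s) - F t^-1.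

(** Minus the derivative of the right tail at x of a function v such that
    v(x + r) = V (1 - 2 m r - A r^2)_+^s.  The left tail is obtained by
    changing m into - m. *)
Definition tail_density {R : realType} (s V m A r : R) : R :=
  V * Num.max 0 (1 - 2 * m * r - A * r ^+ 2) `^ s * r `^ (- (1 + 2 * s)).

Lemma is_derive_inv {R : realType} (m z : R) : 0 < z + m ->
  is_derive z 1 (fun y => (y + m)^-1) (- (z + m)^-1 ^+ 2).
Proof.
move=> zm0.
have d1 : is_derive z 1 (fun y : R => y + m) 1.
  by apply: (is_derive_eq (is_deriveD (is_derive_id z 1) (is_derive_cst m z 1))); rewrite addr0.
have d2 := @is_deriveV _ (fun y : R => y + m) z 1 1 (lt0r_neq0 zm0) d1; apply: (is_derive_eq d2).
by rewrite /GRing.scale/= mulr1 -exprVn.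
Qed.

Lemma is_derive_reciprocal_tail {R : realType} (s V m A t : R) (F : R -> R) :
  0 < s -> (forall r : R, 0 < r -> is_derive r 1 F (- tail_density s V m A r)) ->
  0 < t ->
  is_derive t 1 (reciprocal_tail s V F) (V * t `^ (2 * s - 1) *
    (1 - Num.max 0 (1 - 2 * m * t^-1 - A * t^-1 ^+ 2) `^ s)).
Proof.
move=> s0 dF t0.
have tm0 : 0 < t + 0 by rewrite addr0.
have d1 := is_derive_inv 0 t tm0.
have ti0 : 0 < t^-1 by rewrite invr_gt0.
have d2 := dF _ ti0; rewrite -[t^-1]/((fun y => y^-1) t) -{1}(addr0 t) in d2.
have d3 := @is_derive1_comp R F (fun y => (y + 0)^-1) t _ _ d2 d1.
have d4 := is_derive1_powR (2 * s) t0.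
have d5 : is_derive t 1 (fun t => F t^-1) (- tail_density s V m A t^-1 * - (t + 0)^-1 ^+ 2).
  rewrite (_ : (fun t => F t^-1) = F \o (fun y => (y + 0)^-1))//.
  by apply/funext => y /=; rewrite addr0.
apply: is_derive_eq; rewrite /GRing.scale/= /tail_density addr0.
rewrite powR_invl ?ltW// opprK.
have -> : t `^ (1 + 2 * s) = t `^ (2 * s - 1) * t ^+ 2.
  by rewrite -powR_mulrn ?ltW// -powRD ?(gt_eqF t0) ?implybT//; congr (_ `^ _); ring.
by field; rewrite !gt_eqF.
Qed.

(** The derivative is V t^(2s-1) (1 - Q^s) with Q = 1 + O(1/t), so it is
    O(t^(2s-2)), which tends to 0: a bounded shift of t is harmless in the
    limit.  This allows truncating asymmetrically around x. *)
Lemma reciprocal_tail_shift {R : realType} (s V m A e : R) (F : R -> R) :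
  0 < s -> s < 1 -> 0 <= A -> 0 < e ->
  (forall r : R, 0 < r -> is_derive r 1 F (- tail_density s V m A r)) ->
  exists T0 : R, forall T : R, T0 <= T ->
    `|reciprocal_tail s V F (T + m) - reciprocal_tail s V F T| <= e.
Proof.
move=> s0 s1 A0 e0 dF.
pose C := `|V| * (2 * `|m| + A).
have C0 : 0 <= C by rewrite mulr_ge0// addr_ge0// mulr_ge0.
have D0 : 0 < C * `|m| + 1 by rewrite ltr_wpDl// mulr_ge0.
have p0 : 0 < 2 - 2 * s by lra.
have e'0 : 0 < e / (C * `|m| + 1) by rewrite divr_gt0.
have [T1 T10 hT1] := powR_vanish _ _ p0 e'0.
exists (Num.max T1 1 + `|m|) => T hT.
have hz z : T - `|m| <= z <= T + `|m| -> [/\ 0 < z, 1 <= z & T1 <= z].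
  move=> /andP[z1 _].
  have : T1 <= Num.max T1 1 by rewrite le_max lexx.
  have : 1 <= Num.max T1 1 by rewrite le_max lexx orbT.
  by move=> h1 h2; split; lra.
have key := @le_MVT_norm R (reciprocal_tail s V F) _ (C * (e / (C * `|m| + 1)))
  (T - `|m|) (T + `|m|) T (T + m)
  (fun z hzz => is_derive_reciprocal_tail s V m A z F s0 dF (let: And3 z0 _ _ := hz z hzz in z0)).
have mm : - `|m| <= m <= `|m| by rewrite -ler_norml.
have m0 : 0 <= `|m| by [].
apply: le_trans (key _ _ _) _.
- move=> z /hz[z0 z1 zT1].
  have zi0 : 0 <= z^-1 by rewrite invr_ge0 ltW.
  have zi1 : z^-1 <= 1 by rewrite invf_le1.
  set Q := 1 - _ - _.
  have h1 : `|1 - Num.max 0 Q `^ s| <= (2 * `|m| + A) * z^-1.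
    apply: le_trans (dist1_powR _ _ s0 s1 _) _; first by rewrite le_max lexx.
    have h2 : `|1 - Q| <= (2 * `|m| + A) * z^-1.
      have -> : 1 - Q = 2 * m * z^-1 + A * z^-1 * z^-1 by rewrite /Q; ring.
      rewrite [leRHS]mulrDl; apply: le_trans (ler_normD _ _) _; apply: lerD.
        by rewrite !normrM (ger0_norm zi0) ger0_norm.
      by rewrite ger0_norm ?mulr_ge0// ler_piMr// mulr_ge0.
    apply: le_trans h2; have [Q0|Q0] := leP Q 0; last by [].
    by rewrite subr0 normr1 ger0_norm; lra.
  rewrite !normrM (ger0_norm (powR_ge0 _ _)).
  apply: le_trans (_ : `|V| * z `^ (2 * s - 1) * ((2 * `|m| + A) * z^-1) <= _).
    by rewrite ler_wpM2l// mulr_ge0// powR_ge0.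
  have -> : `|V| * z `^ (2 * s - 1) * ((2 * `|m| + A) * z^-1) = C * z `^ (- (2 - 2 * s)).
    have -> : z `^ (- (2 - 2 * s)) = z `^ (2 * s - 1) * z^-1.
      by rewrite -powR_inv1 ?ltW// -powRD ?(gt_eqF z0) ?implybT//; congr (_ `^ _); ring.
    by rewrite /C; ring.
  by rewrite ler_wpM2l// hT1.
- by apply/andP; split; lra.
- by apply/andP; split; lra.
have -> : T + m - T = m by ring.
rewrite (_ : C * _ * _ = C * `|m| / (C * `|m| + 1) * e); last by ring.
by apply: ler_piMl; [exact: ltW|rewrite ler_pdivrMr// mul1r lerDl].
Qed.

(** With u = 1/(z + m), the quadratic 1 - 2 m u - A u^2 is (z^2 - k^2) u^2, so
    that the powers of u combine to a single factor 1/(z + m). *)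
Lemma is_derive_tail_inv {R : realType} (s V m A k z : R) (F : R -> R) :
  0 < s -> (forall r : R, 0 < r -> is_derive r 1 F (- tail_density s V m A r)) ->
  k ^+ 2 = m ^+ 2 + A -> `|m| < k -> k <= z ->
  is_derive z 1 (fun y => F (y + m)^-1) (V * (z ^+ 2 - k ^+ 2) `^ s / (z + m)).
Proof.
move=> s0 dF k2 mk kz; move: mk; rewrite ltr_norml => /andP[mk1 mk2].
have zm0 : 0 < z + m by lra.
have d1 := is_derive_inv m z zm0.
have ti0 : 0 < (z + m)^-1 by rewrite invr_gt0.
have d2 := dF _ ti0.
have d3 := @is_derive1_comp R F (fun y => (y + m)^-1) z _ _ d2 d1.
apply: (is_derive_eq d3); rewrite /tail_density.
have zk : 0 <= z ^+ 2 - k ^+ 2 by rewrite subr_ge0 ler_sqr ?nnegrE; lra.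
have -> : 1 - 2 * m * (z + m)^-1 - A * (z + m)^-1 ^+ 2 = (z ^+ 2 - k ^+ 2) * (z + m)^-1 ^+ 2.
  by rewrite k2; field; rewrite gt_eqF.
have i2 : 0 <= (z + m)^-1 ^+ 2 by rewrite exprn_ge0// ltW.
rewrite (max_r (mulr_ge0 zk i2)) powRM//; set u := (z + m)^-1.
have -> : (u ^+ 2) `^ s = u `^ (2 * s) by rewrite -powR_mulrn ?(ltW ti0)// -powRrM.
have -> : u `^ (- (1 + 2 * s)) = (u `^ (2 * s))^-1 * u^-1.
  rewrite -powRN -(powR_inv1 (ltW ti0)) -powRD ?(gt_eqF ti0) ?implybT//.
  by congr (_ `^ _); ring.
have n0 : u `^ (2 * s) != 0 by rewrite gt_eqF ?powR_gt0.
by field; rewrite n0 gt_eqF.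
Qed.

(** Truncating at the reciprocals of T + m and T - m makes the tails explicit:
    the two derivatives in T are V (T^2 - k^2)^s/(T + m) and
    V (T^2 - k^2)^s/(T - m), and since k^2 - m^2 = A their sum is the
    derivative of V A^s G((T^2 - k^2)/A).  All terms vanish at T = k. *)
Lemma paired_tails {R : realType} (s V m A k T : R) (G Fp Fm : R -> R) :
  0 < s -> 0 < A -> k ^+ 2 = m ^+ 2 + A -> `|m| < k -> k <= T ->
  (forall X : R, 0 <= X -> is_derive X 1 G (X `^ s / (1 + X))) -> G 0 = 0 ->
  (forall r : R, 0 < r -> is_derive r 1 Fp (- tail_density s V m A r)) ->
  (forall r : R, 0 < r -> is_derive r 1 Fm (- tail_density s V (- m) A r)) ->
  Fp (k + m)^-1 = 0 -> Fm (k - m)^-1 = 0 ->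
  Fp (T + m)^-1 + Fm (T - m)^-1 = V * A `^ s * G ((T ^+ 2 - k ^+ 2) / A).
Proof.
move=> s0 A0 k2 mk kT dG G0 dp dm p0 m0.
have mk' : `|- m| < k by rewrite normrN.
have k2' : k ^+ 2 = (- m) ^+ 2 + A by rewrite sqrrN.
apply: (@eq_derive_eq R (fun z => Fp (z + m)^-1 + Fm (z - m)^-1)
  (fun z => V * A `^ s * G ((z ^+ 2 - k ^+ 2) / A)) _ k T kT).
- move=> z /andP[kz _].
  have d1 := is_derive_tail_inv s V m A k z Fp s0 dp k2 mk kz.
  have d2 := is_derive_tail_inv s V (- m) A k z Fm s0 dm k2' mk' kz.
  exact: (is_deriveD d1 d2).
- move=> z /andP[kz _].
  move: mk; rewrite ltr_norml => /andP[mk1 mk2].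
  have zk : 0 <= z ^+ 2 - k ^+ 2 by rewrite subr_ge0 ler_sqr ?nnegrE; lra.
  have X0 : 0 <= (z ^+ 2 - k ^+ 2) / A by rewrite divr_ge0// ltW.
  have d1 : is_derive z 1 (fun y : R => (y ^+ 2 - k ^+ 2) / A) (2 * z / A).
    by apply: is_derive_eq; rewrite /GRing.scale/=; field; rewrite gt_eqF.
  have d2 := @is_derive1_comp R G _ z _ _ (dG _ X0) d1.
  have d3 := is_deriveZ (V * A `^ s) d2.
  apply: (is_derive_eq d3); rewrite /GRing.scale/=.
  have -> : (z ^+ 2 - k ^+ 2) `^ s = A `^ s * ((z ^+ 2 - k ^+ 2) / A) `^ s.
    by rewrite -powRM// ?(ltW A0)//; congr (_ `^ _); field; rewrite gt_eqF.
  have e1 : 1 + (z ^+ 2 - k ^+ 2) / A = (z + m) * (z - m) / A.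
    by rewrite k2; field; rewrite gt_eqF.
  by rewrite e1; field; rewrite !gt_eqF//; lra.
by rewrite p0 m0 subrr mul0r G0 mulr0 addr0.
Qed.

(** The first-order terms in z cancel, and the second derivative is bounded. *)
Lemma even_part_quadratic {R : realType} (a e : R) :
  exists C d : R, [/\ 0 <= C, 0 < d & forall z : R, -d < z < d ->
    `|(1 + a * z) `^ e + (1 - a * z) `^ e - 2| <= C * z ^+ 2].
Proof.
have a0 : 0 <= `|a| by [].
(* For |z| < d the bases 1 + a z and 1 - a z stay in [1/2, 2]. *)
pose d := (2 * (`|a| + 1))^-1.
have d0 : 0 < d by rewrite invr_gt0; lra.
have haz z : -d < z < d -> 1 / 2 <= 1 + a * z <= 2 /\ 1 / 2 <= 1 + - a * z <= 2.
  move=> hz; have : `|a * z| <= 1 / 2.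
    rewrite normrM; have zd : `|z| <= d
      by rewrite ler_norml; case/andP: hz => h1 h2; apply/andP; split; lra.
    apply: le_trans (_ : `|a| * d <= _); first by rewrite ler_wpM2l.
    by rewrite /d ler_pdivrMr; lra.
  by rewrite ler_norml mulNr => /andP[h1 h2]; split; apply/andP; split; lra.
have der (b e' z : R) : 1 / 2 <= 1 + b * z <= 2 ->
    is_derive z 1 (fun y => (1 + b * y) `^ e') (e' * b * (1 + b * z) `^ (e' - 1)).
  by move=> /andP[h1 h2]; apply: is_derive_affine_powR; lra.
pose f1 z := e * a * (1 + a * z) `^ (e - 1) + e * - a * (1 + - a * z) `^ (e - 1).
pose f2 z := e * a * ((e - 1) * a * (1 + a * z) `^ (e - 1 - 1)) +
             e * - a * ((e - 1) * - a * (1 + - a * z) `^ (e - 1 - 1)).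
pose M := `|e * a| * (`|(e - 1) * a| * 2 `^ `|e - 1 - 1|).
have M0 : 0 <= M by rewrite mulr_ge0// mulr_ge0// powR_ge0.
exists (M + M), d; split => //; first exact: addr_ge0.
move=> z hz.
apply: (@le_norm_from0_2 R (fun z => (1 + a * z) `^ e + (1 - a * z) `^ e - 2) f1 f2 d).
- move=> y /haz[h1 h2].
  have D1 := der _ e _ h1; have D2 := der _ e _ h2.
  have -> : (fun z => (1 + a * z) `^ e + (1 - a * z) `^ e - 2) =
    (fun z => (1 + a * z) `^ e + (1 + - a * z) `^ e - 2) by apply/funext => t; rewrite mulNr.
  by apply: is_derive_eq; rewrite subr0.
- move=> y /haz[h1 h2].
  have D1 := der _ (e - 1) _ h1; have D2 := der _ (e - 1) _ h2.
  exact: (is_deriveD (is_deriveZ (e * a) D1) (is_deriveZ (e * - a) D2)).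
- move=> y /haz[h1 h2]; apply: le_trans (ler_normD _ _) _; apply: lerD.
    by rewrite /M !normrM ler_wpM2l ?mulr_ge0// ler_wpM2l ?mulr_ge0// ger0_norm ?powR_ge0// powR_le_near1.
  by rewrite /M !normrM !normrN ler_wpM2l ?mulr_ge0// ler_wpM2l ?mulr_ge0// ger0_norm ?powR_ge0// powR_le_near1.
- by rewrite !mulr0 addr0 subr0 powR1; ring.
- by rewrite /f1 !mulr0 addr0 powR1; ring.
- exact: hz.
Qed.

(** After factoring out T^(2s), what remains is O(1/T^2): the first two powers
    by evenness in m/T, the third one because its base is 1 - (k/T)^2. *)
Lemma paired_powers_vanish {R : realType} (s m k e : R) : 0 < s -> s < 1 -> 0 < e ->
  exists T0 : R, forall T : R, T0 <= T ->
    `|(T + m) `^ (2 * s) + (T - m) `^ (2 * s) - 2 * (T ^+ 2 - k ^+ 2) `^ s| <= e.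
Proof.
move=> s0 s1 e0; have [C [d [C0 d0 hC]]] := even_part_quadratic m (2 * s).
have k20 : 0 <= k ^+ 2 by exact: sqr_ge0.
have D0 : 0 < C + 2 * k ^+ 2 + 1 by lra.
have p0 : 0 < 2 - 2 * s by lra.
have e'0 : 0 < e / (C + 2 * k ^+ 2 + 1) by rewrite divr_gt0.
have [T1 T10 hT1] := powR_vanish _ _ p0 e'0.
have di0 : 0 < d^-1 by rewrite invr_gt0.
have m0 : 0 <= `|m| by [].
have kk0 : 0 <= `|k| by [].
exists (T1 + d^-1 + `|m| + `|k| + 1) => T hT.
have T0 : 0 < T by lra.
have hm : - `|m| <= m <= `|m| by rewrite -ler_norml.
pose z := T^-1.
have z0 : 0 < z by rewrite invr_gt0.
have zd : -d < z < d.
  by apply/andP; split; [lra|rewrite /z -[ltRHS]invrK ltf_pV2 ?posrE//; lra].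
have T2 : (T ^+ 2) `^ s = T `^ (2 * s) by rewrite -powR_mulrn ?ltW// -powRrM.
have -> : T + m = T * (1 + m * z) by rewrite /z; field; rewrite gt_eqF.
have -> : T - m = T * (1 - m * z) by rewrite /z; field; rewrite gt_eqF.
have -> : T ^+ 2 - k ^+ 2 = T ^+ 2 * (1 - (k * z) ^+ 2) by rewrite /z; field; rewrite gt_eqF.
have h1 : 0 <= 1 + m * z.
  by rewrite -(pmulr_rge0 _ T0) mulrDr /z mulrCA divff ?gt_eqF//; lra.
have h2 : 0 <= 1 - m * z.
  by rewrite -(pmulr_rge0 _ T0) mulrBr /z mulrCA divff ?gt_eqF//; lra.
have kz : `|k * z| <= 1.
  rewrite normrM (ger0_norm (ltW z0)) /z ler_pdivrMr//; lra.
have h3 : 0 <= 1 - (k * z) ^+ 2.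
  by move: kz; rewrite ler_norml => /andP[kz1 kz2]; nra.
have T20 : 0 <= T ^+ 2 by exact: sqr_ge0.
rewrite (powRM _ (ltW T0) h1) (powRM _ (ltW T0) h2) (powRM _ T20 h3) T2.
set p := T `^ (2 * s).
have -> : p * (1 + m * z) `^ (2 * s) + p * (1 - m * z) `^ (2 * s) -
    2 * (p * (1 - (k * z) ^+ 2) `^ s) =
  p * (((1 + m * z) `^ (2 * s) + (1 - m * z) `^ (2 * s) - 2) +
       2 * (1 - (1 - (k * z) ^+ 2) `^ s)) by ring.
have b1 := hC z zd.
have b2 : `|1 - (1 - (k * z) ^+ 2) `^ s| <= k ^+ 2 * z ^+ 2.
  apply: le_trans (dist1_powR _ _ s0 s1 h3) _.
  by rewrite subKr ger0_norm ?sqr_ge0// exprMn.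
have p_ge0 : 0 <= p by exact: powR_ge0.
rewrite normrM (ger0_norm p_ge0).
apply: le_trans (_ : p * ((C + 2 * k ^+ 2) * z ^+ 2) <= _).
  rewrite ler_wpM2l//; apply: le_trans (ler_normD _ _) _.
  by rewrite normrM (@ger0_norm _ 2)//; lra.
have -> : p * ((C + 2 * k ^+ 2) * z ^+ 2) = (C + 2 * k ^+ 2) * T `^ (- (2 - 2 * s)).
  have -> : T `^ (- (2 - 2 * s)) = p * z ^+ 2.
    rewrite opprB powRB ?(gt_eqF T0) ?implybT//; congr (_ * _).
    by rewrite powR_mulrn ?(ltW T0)// /z exprVn.
  by ring.
have TT1 : T1 <= T by lra.
apply: le_trans (_ : (C + 2 * k ^+ 2) * (e / (C + 2 * k ^+ 2 + 1)) <= _).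
  by rewrite ler_wpM2l ?hT1//; lra.
rewrite (_ : _ * (e / _) = (C + 2 * k ^+ 2) / (C + 2 * k ^+ 2 + 1) * e); last by ring.
by apply: ler_piMl; [exact: ltW|rewrite ler_pdivrMr// mul1r lerDl].
Qed.

(** With T = 1/r, shift T to T + m in one tail and to T - m in the other
    (reciprocal_tail_shift), apply paired_tails, and replace
    (T + m)^(2s) + (T - m)^(2s) by 2 (T^2 - k^2)^s (paired_powers_vanish).
    What is left is V A^s (X^s/s - G(X)) with X = (T^2 - k^2)/A. *)
Lemma torsion_limit {R : realType} (s V m A kappa : R) (G Fp Fm : R -> R) :
  let k := Num.sqrt (m ^+ 2 + A) in
  0 < s -> s < 1 -> 0 < A -> 0 < V -> G 0 = 0 ->
  (forall X : R, 0 <= X -> is_derive X 1 G (X `^ s / (1 + X))) ->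
  X `^ s / s - G X @[X --> +oo%R] --> kappa ->
  (forall r : R, 0 < r -> is_derive r 1 Fp (- tail_density s V m A r)) ->
  (forall r : R, 0 < r -> is_derive r 1 Fm (- tail_density s V (- m) A r)) ->
  Fp (k + m)^-1 = 0 -> Fm (k - m)^-1 = 0 ->
  V * r `^ (- (2 * s)) / s - Fm r - Fp r @[r --> 0^'+] --> V * A `^ s * kappa.
Proof.
move=> k s0 s1 A0 V0 G0 dG limG dp dm p0 m0.
have mA0 : 0 <= m ^+ 2 + A by rewrite addr_ge0 ?sqr_ge0// ltW.
have k2 : k ^+ 2 = m ^+ 2 + A by rewrite sqr_sqrtr.
have k0 : 0 <= k by exact: sqrtr_ge0.
have mk : `|m| < k.
  rewrite -(@ltr_sqr _ `|m| k) ?nnegrE// k2 real_normK ?num_real//; lra.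
have W0 : 0 < V * A `^ s by rewrite mulr_gt0// powR_gt0.
apply/cvgrPdist_le => e e0.
have e4 : 0 < e / 4 by lra.
have eW : 0 < e / 4 / (V * A `^ s) by rewrite divr_gt0.
have eV : 0 < e / 4 / (V / (2 * s)) by rewrite divr_gt0// divr_gt0// mulr_gt0.
have [Tp hTp] := reciprocal_tail_shift s V m A _ Fp s0 s1 (ltW A0) e4 dp.
have [Tm hTm] := reciprocal_tail_shift s V (- m) A _ Fm s0 s1 (ltW A0) e4 dm.
have [TB hTB] := paired_powers_vanish s m k _ s0 s1 eV.
have [X0 hX0] : exists X0, forall X, X0 <= X ->
    `|kappa - (X `^ s / s - G X)| <= e / 4 / (V * A `^ s).
  have /cvgrPdist_le/(_ _ eW)[M [_ hM]] := limG.
  by exists (M + 1) => X hX; apply: hM; lra.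
pose T0 := `|Tp| + `|Tm| + `|TB| + `|X0| * A + k ^+ 2 + k + 1.
have kk : 0 <= k ^+ 2 by exact: sqr_ge0.
have XA : 0 <= `|X0| * A by rewrite mulr_ge0// ltW.
have : [/\ 0 <= `|Tp|, 0 <= `|Tm|, 0 <= `|TB| & 0 <= `|X0|] by split.
move=> [n1 n2 n3 n4].
have T00 : 0 < T0 by rewrite /T0; lra.
near=> r.
have r0 : 0 < r by [].
have hr : r <= T0^-1 by near: r; apply: nbhs_right_ltW; rewrite invr_gt0.
pose T := r^-1.
have TT0 : T0 <= T by rewrite /T -[T0]invrK lef_pV2 ?posrE ?invr_gt0.
have T_gt0 : 0 < T by exact: lt_le_trans TT0.
have -> : r = T^-1 by rewrite invrK.
rewrite powR_invl ?(ltW T_gt0)// opprK.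
have l1 := ler_norm Tp; have l2 := ler_norm Tm; have l3 := ler_norm TB; have l4 := ler_norm X0.
have [tp tm tb kT [t1 tX]] : [/\ Tp <= T, Tm <= T, TB <= T, k <= T &
    1 <= T /\ `|X0| * A + k ^+ 2 <= T].
  move: TT0; rewrite /T0; clear - n1 n2 n3 l1 l2 l3 XA kk k0 => TT0.
  by split; [lra|lra|lra|lra|split; lra].
have b1 : `|reciprocal_tail s V Fp (T + m) - reciprocal_tail s V Fp T| <= e / 4.
  exact: hTp.
have b2 : `|reciprocal_tail s V Fm (T - m) - reciprocal_tail s V Fm T| <= e / 4.
  exact: hTm.
have b3 : `|(T + m) `^ (2 * s) + (T - m) `^ (2 * s) - 2 * (T ^+ 2 - k ^+ 2) `^ s|
  <= e / 4 / (V / (2 * s)).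
  exact: hTB.
set X := (T ^+ 2 - k ^+ 2) / A.
have X_ge : X0 <= X.
  rewrite /X ler_pdivlMr//; apply: le_trans (_ : `|X0| * A <= _).
    by rewrite ler_wpM2r// ltW.
  have T2 : T <= T ^+ 2 by rewrite expr2 ler_peMl ?(ltW T_gt0).
  by clear - T2 tX; lra.
have b4 := hX0 _ X_ge.
have E := paired_tails s V m A k T G Fp Fm s0 A0 k2 mk kT dG G0 dp dm p0 m0.
have TX : (T ^+ 2 - k ^+ 2) `^ s = A `^ s * X `^ s.
  have Tk : 0 <= T ^+ 2 - k ^+ 2 by rewrite subr_ge0 ler_sqr ?nnegrE// ltW.
  by rewrite -powRM ?(ltW A0) ?divr_ge0
    ?(ltW A0)//; congr (_ `^ _); rewrite /X; field; rewrite gt_eqF.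
move: b1 b2; rewrite /reciprocal_tail.
set pT := T `^ (2 * s); set pTp := (T + m) `^ (2 * s) in b3 *; set pTm := (T - m) `^ (2 * s) in b3 *.
move=> b1 b2.
have b3' : `|V / (2 * s) * (pTp + pTm - 2 * (T ^+ 2 - k ^+ 2) `^ s)| <= e / 4.
  by rewrite normrM ger0_norm ?divr_ge0 ?(ltW V0) ?mulr_ge0
    ?(ltW s0)// mulrC -ler_pdivlMr// divr_gt0// mulr_gt0.
have b4' : `|V * A `^ s * (kappa - (X `^ s / s - G X))| <= e / 4.
  by rewrite normrM (gtr0_norm W0) mulrC -ler_pdivlMr.
rewrite (_ : _ - _ = V * A `^ s * (kappa - (X `^ s / s - G X))
  + (V * pTp / (2 * s) - Fp (T + m)^-1 - (V * pT / (2 * s) - Fp T^-1))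
  + (V * pTm / (2 * s) - Fm (T - m)^-1 - (V * pT / (2 * s) - Fm T^-1))
  - V / (2 * s) * (pTp + pTm - 2 * (T ^+ 2 - k ^+ 2) `^ s)); last first.
  have -> : Fp (T + m)^-1 = V * A `^ s * G X - Fm (T - m)^-1 by rewrite -E addrK.
  by rewrite TX; field; rewrite gt_eqF.
have -> : e = e / 4 + e / 4 + e / 4 + e / 4 by field.
apply: le_trans (ler_normB _ _) _; apply: lerD => //.
apply: le_trans (ler_normD _ _) _; apply: lerD => //.
by apply: le_trans (ler_normD _ _) _; apply: lerD.
Unshelve. all: by end_near. Qed.

(** * The fractional Laplacian of a torsion function *)

(** The solution, up to a factor, of the problem (-Delta)^s T = 1 on the interval
    (- 1/a, 1/g), T = 0 outside: the so-called torsion function.  It is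
    normalized by T(0) = 1. *)
Definition torsion {R : realType} (s a g y : R) : R :=
  Num.max 0 ((1 + a * y) * (1 - g * y)) `^ s.

Lemma continuous_torsion {R : realType} (s a g : R) : 0 < s -> continuous (torsion s a g).
Proof.
move=> s0 y.
apply: (@continuous_comp _ _ _ (fun y : R => (1 + a * y) * (1 - g * y))
  (fun t : R => Num.max 0 t `^ s)); last exact: continuous_max0_powR.
have d : is_derive y 1 (fun y : R => (1 + a * y) * (1 - g * y))
    (a * (1 - g * y) - g * (1 + a * y)).
  by apply: is_derive_eq; rewrite /GRing.scale/=; ring.
exact: is_derive_continuous d.
Qed.

Lemma torsion_bounded {R : realType} (s a g : R) : 0 < s -> 0 < a -> 0 < g ->
  exists M, forall y, `|torsion s a g y| <= M.
Proof.
move=> s0 a0 g0; pose B := 1 + (a - g) ^+ 2 / (4 * (a * g)).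
exists (B `^ s) => y; rewrite ger0_norm ?powR_ge0//.
have ag : 0 < a * g by rewrite mulr_gt0.
have B0 : 0 <= B by rewrite addr_ge0// divr_ge0 ?sqr_ge0//; lra.
apply: ge0_ler_powR; rewrite ?nnegrE ?(ltW s0)//; first by rewrite le_max lexx.
rewrite ge_max B0/= -subr_ge0.
have -> : B - (1 + a * y) * (1 - g * y) = a * g * (y - (a - g) / (2 * (a * g))) ^+ 2.
  by rewrite /B; field; rewrite !gt_eqF.
by rewrite mulr_ge0 ?sqr_ge0// ltW.
Qed.

(** At distance u from x the quadratic (1 + a y)(1 - g y) is
    D (1 - 2 m u - A u^2) with D its value at x and A = a g/D.  The limit
    kappa D^s A^s given by torsion_limit does not depend on x. *)
Lemma torsion_laplacian {R : realType} (s : R) : 0 < s -> s < 1 ->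
  exists kappa : R, forall a g x : R, 0 < a -> 0 < g -> 0 < 1 + a * x -> 0 < 1 - g * x ->
    frac_laplacian_eq s (torsion s a g) x (kappa * (a * g) `^ s).
Proof.
move=> s0 s1; have [kappa [G [G0 dG limG]]] := torsion_constant s s0 s1.
exists kappa => a g x a0 g0 ax gx.
have [M hM] := torsion_bounded s a g s0 a0 g0.
have cv := continuous_torsion s a g s0.
pose D := (1 + a * x) * (1 - g * x).
have D0 : 0 < D by rewrite mulr_gt0.
pose A := a * g / D.
have A0 : 0 < A by rewrite divr_gt0// mulr_gt0.
pose m := - (a - g - 2 * (a * g) * x) / (2 * D).
pose V := torsion s a g x.
have VE : V = D `^ s by rewrite /V /torsion max_r// ltW.
have V0 : 0 < V by rewrite VE powR_gt0.
have vE u : torsion s a g (x + u) = V * Num.max 0 (1 - 2 * m * u - A * u ^+ 2) `^ s.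
  rewrite VE -powRM ?(ltW D0)//; last by rewrite le_max lexx.
  rewrite maxr_pMr ?(ltW D0)// mulr0 /torsion; congr (Num.max 0 _ `^ s).
  by rewrite /m /A /D; field; rewrite !gt_eqF.
set k := Num.sqrt (m ^+ 2 + A).
have mA0 : 0 <= m ^+ 2 + A by rewrite addr_ge0 ?sqr_ge0// ltW.
have k2 : k ^+ 2 = m ^+ 2 + A by rewrite sqr_sqrtr.
have k0 : 0 <= k by exact: sqrtr_ge0.
have : `|m| < k by rewrite -(@ltr_sqr _ `|m| k) ?nnegrE// k2 real_normK ?num_real//; lra.
rewrite ltr_norml => /andP[mk1 mk2].
(* The factored form shows that v vanishes beyond distances 1/(k + m) and 1/(k - m). *)
have vE' u : torsion s a g (x + u) = V * Num.max 0 ((1 - (k + m) * u) * (1 + (k - m) * u)) `^ s.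
  rewrite vE; congr (_ * Num.max 0 _ `^ s).
  have -> : A = k ^+ 2 - m ^+ 2 by rewrite k2; ring.
  by ring.
apply: (@pv_integral_eq_tails _ s x M) => //.
have -> : kappa * (a * g) `^ s = V * A `^ s * kappa.
  rewrite VE -powRM ?(ltW D0) ?(ltW A0)// mulrC; congr (_ `^ _ * _).
  by rewrite /A; field; rewrite gt_eqF.
apply: (@torsion_limit R s V m A kappa G) => //.
- move=> r r0; have := is_derive_right_tail s x M r _ s0 cv hM r0.
  by rewrite vE /tail_density.
- move=> r r0; have := is_derive_left_tail s x M r _ s0 cv hM r0.
  rewrite vE /tail_density (_ : 2 * - m * r = 2 * m * - r); last by ring.
  by rewrite sqrrN.
- apply: right_tail_eq0 => y hy; rewrite -(subrKC x y) vE'.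
  have km : 0 < k + m by lra.
  have hu : 1 <= (k + m) * (y - x) by rewrite mulrC -ler_pdivrMr// mul1r; lra.
  have u0 : 0 <= y - x by rewrite -(pmulr_rge0 _ km); lra.
  rewrite max_l ?powR0 ?mulr0 ?(gt_eqF s0)// mulr_le0_ge0//; first by lra.
  by rewrite addr_ge0// mulr_ge0//; lra.
- apply: left_tail_eq0 => y hy; rewrite -(subrKC x y) vE'.
  have km : 0 < k - m by lra.
  have hu : 1 <= (k - m) * (x - y) by rewrite mulrC -ler_pdivrMr// mul1r; lra.
  have u0 : 0 <= x - y by rewrite -(pmulr_rge0 _ km); lra.
  rewrite max_l ?powR0 ?mulr0 ?(gt_eqF s0)// mulr_ge0_le0//.
    have : 0 <= (k + m) * (x - y) by rewrite mulr_ge0//; lra.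
    lra.
  lra.
Qed.

Lemma frac_laplacian_eqD {R : realType} (s x l1 l2 : R) (v1 v2 : R -> R) :
  frac_laplacian_eq s v1 x l1 -> frac_laplacian_eq s v2 x l2 ->
  frac_laplacian_eq s (fun y => v1 y + v2 y) x (l1 + l2).
Proof.
move=> [i1 c1] [i2 c2].
have gE : (fun y => (v1 x + v2 x - (v1 y + v2 y)) / `|x - y| `^ (1 + 2 * s)) =
  (fun y => (v1 x - v1 y) / `|x - y| `^ (1 + 2 * s) + (v2 x - v2 y) / `|x - y| `^ (1 + 2 * s)).
  by apply/funext => y; rewrite -mulrDl; congr (_ / _); ring.
have mB r : measurable (~` ball x r : set (measurableTypeR R)).
  by apply: measurableC; exact: measurable_ball.
split; rewrite gE.
- by move=> r r0; apply: eq_integrable (integrableD (mB r) (i1 r r0) (i2 r r0)) => // y _.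
- apply: cvg_trans (cvgD c1 c2); apply: near_eq_cvg.  near=> r.
  have r0 : 0 < r by [].
  by rewrite /= RintegralD//; [exact: i1|exact: i2].
Unshelve. all: by end_near. Qed.

Lemma frac_laplacian_eqZ {R : realType} (s x l c : R) (v : R -> R) :
  frac_laplacian_eq s v x l -> frac_laplacian_eq s (fun y => c * v y) x (c * l).
Proof.
move=> [i1 c1].
have gE : (fun y => (c * v x - c * v y) / `|x - y| `^ (1 + 2 * s)) =
  (fun y => c * ((v x - v y) / `|x - y| `^ (1 + 2 * s))).
  by apply/funext => y; ring.
have mB r : measurable (~` ball x r : set (measurableTypeR R)).
  by apply: measurableC; exact: measurable_ball.
split; rewrite gE.
- by move=> r r0; apply: eq_integrable (integrableZl (mB r) c (i1 r r0)) => // y _.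
- have lim : c * (\int[@lebesgue_measure R]_(y in ~` ball x r)
      ((v x - v y) / `|x - y| `^ (1 + 2 * s))) @[r --> 0^'+] --> c * l.
    by apply: cvgMr.
  apply: cvg_trans lim; apply: near_eq_cvg; near=> r.
  have r0 : 0 < r by [].
  by rewrite /= RintegralZl//; exact: i1.
Unshelve. all: by end_near. Qed.

(** * The Weierstrass approximation theorem *)

Lemma unif_continuous_segment {R : realType} (f : R -> R) (a b e : R) :
  continuous f -> 0 < e -> exists2 d, 0 < d &
    forall x y, a <= x <= b -> `|x - y| < d -> `|f x - f y| <= e.
Proof.
move=> cf e0.
have /compact_near_coveringP := @segment_compact R a b.
move=> /(_ R (0^'+) (fun d x => forall y, `|x - y| < d -> `|f x - f y| <= e)) [|].
- move=> x _.
  have e2 : 0 < e / 2 by lra.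
  have /cvgrPdist_lt/(_ _ e2)/nbhs_ballP[d /= d0 hd] := cf x.
  have d2 : 0 < d / 2 by lra.
  exists (ball x (d / 2), [set t | t < d / 2]).
    split => /=; first exact: nbhsx_ballx.
    by near=> t; near: t; apply: nbhs_right_lt.
  move=> [z t] /= [xz td] y zy.
  have hz := hd z; have hy := hd y.
  move: xz; rewrite /ball/= => xz.
  have xy : `|x - y| < d.
    rewrite (_ : x - y = (x - z) + (z - y)); last by ring.
    apply: le_lt_trans (ler_normD _ _) _; lra.
  have {}hz : `|f x - f z| < e / 2 by apply: hz; rewrite /ball/=; lra.
  have {}hy : `|f x - f y| < e / 2 by exact: hy.
  rewrite (_ : f z - f y = (f x - f y) - (f x - f z)); last by ring.
  apply: le_trans (ler_normB _ _) _; lra.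
- move=> d [/= d0 hd]; exists (d / 2); first by move: d0 => /=; lra.
  move=> x y xab xy; apply: (hd (d / 2)) => //=.
  + rewrite /ball/= sub0r normrN gtr0_norm; move: d0 => /=; lra.
  + move: d0 => /=; lra.
Unshelve. all: by end_near. Qed.

(** The Bernstein operator sum_k phi(k) C(n, k) t^k (1 - t)^(n-k), through its
    recursion in the degree: monotonicity and the second moment follow by
    induction. *)
Fixpoint bernstein {R : realType} (n : nat) (phi : nat -> R) (t : R) : R :=
  if n is n'.+1 then
    t * bernstein n' (fun k => phi k.+1) t + (1 - t) * bernstein n' phi t
  else phi 0%N.

Lemma bernstein_poly {R : realType} n (phi : nat -> R) :
  exists p : {poly R}, forall t, bernstein n phi t = p.[t].
Proof.
elim: n phi => [|n IH] phi; first by exists ((phi 0%N)%:P) => t; rewrite hornerC.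
have [p hp] := IH phi; have [q hq] := IH (fun k => phi k.+1).
by exists ('X * q + (1 - 'X) * p) => t; rewrite /= hp hq !hornerE.
Qed.

Lemma bernstein_le {R : realType} n (phi psi : nat -> R) (t : R) : 0 <= t <= 1 ->
  (forall k, phi k <= psi k) -> bernstein n phi t <= bernstein n psi t.
Proof.
move=> /andP[t0 t1]; elim: n phi psi => [|n IH] phi psi h //=.
apply: lerD; apply: ler_wpM2l => //; [exact: IH|by rewrite subr_ge0|exact: IH].
Qed.

(** The second moment about c of d times a binomial variable. *)
Lemma bernstein_quadratic {R : realType} n (a b c d t : R) :
  bernstein n (fun k => a + b * (d * k%:R - c) ^+ 2) t =
  a + b * ((d * n%:R * t - c) ^+ 2 + d ^+ 2 * n%:R * t * (1 - t)).
Proof.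
elim: n c => [|n IH] c /=; first by rewrite !mulr0 !mul0r addr0.
rewrite IH (_ : (fun k => _) = (fun k => a + b * (d * k%:R - (c - d)) ^+ 2)).
  by rewrite IH -!(@natr1 _ n); ring.
by apply/funext => k; rewrite -natr1; ring.
Qed.

(** By uniform continuity and boundedness, |f(t) - f(y)| <= e/2 + C (y - t)^2;
    applying the monotone operator to this inequality in y bounds the error
    by e/2 plus C times the variance, which is O(1/n). *)
Lemma weierstrass01 {R : realType} (f : R -> R) (e : R) : continuous f -> 0 < e ->
  exists p : {poly R}, forall t, 0 <= t <= 1 -> `|f t - p.[t]| <= e.
Proof.
move=> cf e0; have e2 : 0 < e / 2 by lra.
have [d d0 hd] := unif_continuous_segment f 0 1 (e / 2) cf e2.
have cnf : {within `[0, 1], continuous (fun x => `|f x|)}.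
  apply: continuous_subspaceT => x; apply: continuous_comp; [exact: cf|exact: norm_continuous].
have [c _ hM] := @EVT_max R (fun x => `|f x|) 0 1 ler01 cnf.
set M := `|f c| in hM.
have M0 : 0 <= M by exact: normr_ge0.
pose C := 2 * M / d ^+ 2.
have C0 : 0 <= C by rewrite divr_ge0 ?sqr_ge0// mulr_ge0.
(* bernstein_le compares the samples at k/n for all k, also for k > n: hence the clamping to [0, 1]. *)
pose cl (y : R) := Num.max 0 (Num.min y 1).
have cl01 y : 0 <= cl y <= 1 by rewrite /cl le_max lexx /= ge_max ler01 /= ge_min lexx orbT.
have hcl t y : 0 <= t <= 1 -> `|t - cl y| <= `|t - y|.
  move=> /andP[t0 t1]; have [y0|y0] := leP y 0.
    have -> : cl y = 0 by rewrite /cl min_l ?max_l//; lra.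
    by rewrite (@ger0_norm _ (t - 0)) ?(@ger0_norm _ (t - y)); lra.
  have [y1|y1] := leP y 1.
    by have -> : cl y = y by rewrite /cl min_l ?max_r//; lra.
  have -> : cl y = 1 by rewrite /cl min_r ?max_r//; lra.
  by rewrite (@ler0_norm _ (t - 1)) ?(@ler0_norm _ (t - y)); lra.
have key t y : 0 <= t <= 1 -> `|f t - f (cl y)| <= e / 2 + C * (y - t) ^+ 2.
  move=> t01; have [ltd|led] := ltP `|t - cl y| d.
    by apply: le_trans (hd _ _ t01 ltd) _; rewrite lerDl mulr_ge0 ?sqr_ge0.
  apply: le_trans (_ : 2 * M <= _).
    apply: le_trans (ler_normB _ _) _.
    have h1 := hM t; have h2 := hM (cl y); rewrite !in_itv/= in h1 h2.
    by have := h1 t01; have := h2 (cl01 y); lra.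
  apply: le_trans (_ : C * (y - t) ^+ 2 <= _); last by lra.
  rewrite /C mulrAC ler_pdivlMr ?exprn_gt0// ler_wpM2l ?mulr_ge0//.
  have h := le_trans led (hcl t y t01).
  rewrite -(real_normK (num_real (y - t))) distrC ler_sqr ?nnegrE//; exact: ltW.
pose n := (Num.bound (C / (e / 2))).+1.
have n0 : 0 < n%:R :> R by rewrite ltr0n.
have hn : C / n%:R <= e / 2.
  have : C / (e / 2) < n%:R.
    have := @archi_boundP R (C / (e / 2)); rewrite divr_ge0 ?(ltW e2)// => /(_ isT) h.
    by apply: lt_le_trans h _; rewrite ler_nat.
  by rewrite ltr_pdivrMr// => h; rewrite ler_pdivrMr// mulrC; exact: ltW.
have [p hp] := bernstein_poly n (fun k => f (cl (n%:R^-1 * k%:R))).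
exists p => t t01; rewrite -hp.
have tt : t * (1 - t) <= 1 by case/andP: t01 => t0 t1; nra.
have E (b : R) (cc : R) : bernstein n (fun k => cc + b * (n%:R^-1 * k%:R - t) ^+ 2) t =
    cc + b * (t * (1 - t)) / n%:R.
  by rewrite bernstein_quadratic; field; rewrite gt_eqF.
have up : bernstein n (fun k => f (cl (n%:R^-1 * k%:R))) t
  <= f t + e / 2 + C * (t * (1 - t)) / n%:R.
  rewrite -E; apply: bernstein_le => // k.
  by have := key t (n%:R^-1 * k%:R) t01; rewrite ler_norml => /andP[]; lra.
have dn : f t - e / 2 + (- C) * (t * (1 - t)) / n%:R
  <= bernstein n (fun k => f (cl (n%:R^-1 * k%:R))) t.
  rewrite -E; apply: bernstein_le => // k.
  by have := key t (n%:R^-1 * k%:R) t01; rewrite ler_norml => /andP[]; lra.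
have : C * (t * (1 - t)) / n%:R <= e / 2.
  apply: le_trans hn; rewrite ler_wpM2r ?invr_ge0 ?(ltW n0)//.
  by rewrite ler_piMr.
rewrite !mulNr in dn.
by move=> h; rewrite ler_norml; apply/andP; split; lra.
Qed.

Lemma weierstrass {R : realType} (f : R -> R) (a b e : R) : a < b -> continuous f ->
  0 < e -> exists p : {poly R}, forall x, a <= x <= b -> `|f x - p.[x]| <= e.
Proof.
move=> ab cf e0; have ba : 0 < b - a by lra.
have cg : continuous (fun t => f (a + (b - a) * t)).
  move=> t; apply: (@continuous_comp _ _ _ (fun t : R => a + (b - a) * t) f); last exact: cf.
  exact: is_derive_continuous (is_derive_affine a (b - a) t).
have [p hp] := weierstrass01 _ _ cg e0.
exists (p \Po ((b - a)^-1 *: ('X - a%:P))) => x /andP[ax xb].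
rewrite horner_comp !hornerE.
have -> : f x = f (a + (b - a) * ((b - a)^-1 * (x - a))).
  by congr f; field; lra.
apply: hp; apply/andP; split.
  by rewrite mulr_ge0 ?invr_ge0; lra.
by rewrite mulrC ler_pdivrMr; lra.
Qed.

(** * Uniform density of the powers of affine functions *)

Definition powers_sum {R : realType} (e : R) (l : seq (R * R)) (x : R) : R :=
  \sum_(p <- l) p.1 * (1 + p.2 * x) `^ e.

(** The bound 1/4 keeps 1 + a x in [1/2, 2] for |x| <= 2, so that all powers are
    smooth with uniform bounds. *)
Definition slow {R : realType} (l : seq (R * R)) : bool :=
  all (fun p => 0 < p.2 <= 1 / 4) l.

Definition approximable {R : realType} (e : R) (f : R -> R) : Prop :=
  forall eta, 0 < eta -> exists2 l, slow l &
    forall x, -2 <= x <= 2 -> `|f x - powers_sum e l x| <= eta.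

Lemma powers_sum_cat {R : realType} (e : R) l1 l2 (x : R) :
  powers_sum e (l1 ++ l2) x = powers_sum e l1 x + powers_sum e l2 x.
Proof. by rewrite /powers_sum big_cat. Qed.

Lemma approximable_lim {R : realType} (e : R) (f : R -> R) :
  (forall eta, 0 < eta -> exists2 g, approximable e g &
    forall x, -2 <= x <= 2 -> `|f x - g x| <= eta) -> approximable e f.
Proof.
move=> H eta eta0; have e2 : 0 < eta / 2 by lra.
have [g ag fg] := H _ e2; have [l sl gl] := ag _ e2; exists l => // x hx.
rewrite (_ : _ - _ = (f x - g x) + (g x - powers_sum e l x)); last by ring.
by apply: le_trans (ler_normD _ _) _; have := fg x hx; have := gl x hx; lra.
Qed.

Lemma approximableD {R : realType} (e : R) (f g : R -> R) :
  approximable e f -> approximable e g -> approximable e (fun x => f x + g x).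
Proof.
move=> af ag eta eta0; have e2 : 0 < eta / 2 by lra.
have [l sl fl] := af _ e2; have [k sk gk] := ag _ e2.
exists (l ++ k); first by rewrite /slow all_cat; apply/andP.
move=> x hx; rewrite powers_sum_cat.
rewrite (_ : _ - _ = (f x - powers_sum e l x) + (g x - powers_sum e k x)); last by ring.
by apply: le_trans (ler_normD _ _) _; have := fl x hx; have := gk x hx; lra.
Qed.

Lemma approximableZ {R : realType} (e c : R) (f : R -> R) :
  approximable e f -> approximable e (fun x => c * f x).
Proof.
move=> af eta eta0; have c0 : 0 <= `|c| by [].
have e2 : 0 < eta / (`|c| + 1) by rewrite divr_gt0//; lra.
have [l sl fl] := af _ e2.
exists [seq (c * p.1, p.2) | p <- l]; first by rewrite /slow all_map.
move=> x hx; rewrite /powers_sum big_map /=.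
under eq_bigr do rewrite -mulrA.
rewrite -mulr_sumr -mulrBr normrM.
apply: le_trans (_ : `|c| * (eta / (`|c| + 1)) <= _); first by rewrite ler_wpM2l// fl.
rewrite (_ : _ * _ = `|c| / (`|c| + 1) * eta); last by ring.
by apply: ler_piMl; [exact: ltW|rewrite ler_pdivrMr; lra].
Qed.

Lemma approximable0 {R : realType} (e : R) : approximable e (fun=> 0).
Proof.
move=> eta eta0; exists [::] => // x _.
by rewrite /powers_sum big_nil subrr normr0 ltW.
Qed.

Lemma affine_bounds {R : realType} (a x : R) : 0 <= a <= 1 / 4 -> -2 <= x <= 2 ->
  1 / 2 <= 1 + a * x <= 2.
Proof. move=> /andP[a0 a1] /andP[x0 x1]; apply/andP; split; nra. Qed.

Lemma powR_lipschitz {R : realType} (c a b x : R) :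
  0 <= a <= 1 / 4 -> 0 <= b <= 1 / 4 -> -2 <= x <= 2 ->
  `|(1 + b * x) `^ c - (1 + a * x) `^ c| <= 2 * `|c| * 2 `^ `|c - 1| * `|b - a|.
Proof.
move=> ha hb hx.
apply: (@le_MVT_norm R (fun y => (1 + y * x) `^ c)
  (fun y => c * x * (1 + y * x) `^ (c - 1)) _ 0 (1 / 4)) => // y hy.
- have /andP[h _] := affine_bounds y x hy hx.
  rewrite (_ : (fun y => _) = (fun y => (1 + x * y) `^ c)); last first.
    by apply/funext => z; rewrite mulrC.
  by rewrite (mulrC y); apply: is_derive_affine_powR; rewrite mulrC; lra.
- rewrite !normrM (ger0_norm (powR_ge0 _ _)).
  have x2 : `|x| <= 2 by rewrite ler_norml; case/andP: hx => h1 h2; apply/andP.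
  have h := powR_le_near1 _ (c - 1) (affine_bounds y x hy hx).
  have q : `|c| * `|x| <= 2 * `|c| by rewrite mulrC ler_wpM2r.
  exact: ler_pM (mulr_ge0 (normr_ge0 c) (normr_ge0 x)) (powR_ge0 _ _) q h.
Qed.

(** Up to a constant, x^k (1 + a x)^(e-k) is the k-th derivative in a of
    (1 + a x)^e, and a difference quotient in a of two approximable functions
    is approximable.  No constant e - k vanishes because e < 0. *)
Lemma approximable_monomial {R : realType} (e : R) (k : nat) (a : R) : e < 0 ->
  0 <= a < 1 / 4 -> approximable e (fun x => x ^+ k * (1 + a * x) `^ (e - k%:R)).
Proof.
move=> e0; elim: k a => [|k IH] a /andP[a0 a1].
- apply: approximable_lim => eta eta0.
  set L := 2 * `|e| * 2 `^ `|e - 1|.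
  have L0 : 0 <= L by rewrite !mulr_ge0// powR_ge0.
  (* The sums have positive parameters only: the value a = 0 is reached as a limit. *)
  pose d := Num.min (1 / 4 - a) (eta / (L + 1)).
  have d0 : 0 < d by rewrite lt_min subr_gt0 a1 divr_gt0//; lra.
  have d1 : d <= 1 / 4 - a by rewrite ge_min lexx.
  have d2 : d <= eta / (L + 1) by rewrite ge_min lexx orbT.
  exists (fun x => (1 + (a + d) * x) `^ e).
    move=> et et0; exists [:: (1, a + d)].
      by rewrite /slow /= andbT; apply/andP; split; lra.
    by move=> x _; rewrite /powers_sum big_seq1 /= mul1r subrr normr0 ltW.
  move=> x hx; rewrite mul1r subr0 distrC.
  apply: le_trans (powR_lipschitz _ _ _ _ _ _ hx) _.
    by apply/andP; split; lra.
    by apply/andP; split; lra.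
  rewrite (_ : a + d - a = d); last by ring.
  have L1 : 0 < L + 1 by lra.
  by rewrite -/L (ger0_norm (ltW d0)); move: d2; rewrite ler_pdivlMr//; lra.
- apply: approximable_lim => eta eta0.
  pose c := e - k%:R.
  have c0 : c != 0 by rewrite lt_eqF// /c subr_lt0 (lt_le_trans e0)// ler0n.
  have cp : 0 < `|c| by rewrite normr_gt0.
  set L := 2 ^+ k.+1 * (2 * `|c - 1| * 2 `^ `|c - 1 - 1|).
  have L0 : 0 <= L by rewrite !mulr_ge0// ?powR_ge0// exprn_ge0.
  pose d := Num.min (1 / 8 - a / 2) (eta / (L + 1)).
  have d0 : 0 < d by rewrite lt_min divr_gt0// ?andbT; lra.
  have d1 : d <= 1 / 8 - a / 2 by rewrite ge_min lexx.
  have d2 : d <= eta / (L + 1) by rewrite ge_min lexx orbT.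
  (* g is the difference quotient in a, divided by the exponent c. *)
  pose g x := (d * c)^-1 * (x ^+ k * (1 + (a + d) * x) `^ c) +
    (- (d * c)^-1) * (x ^+ k * (1 + a * x) `^ c).
  exists g.
    by apply: approximableD; apply: approximableZ; apply: IH; apply/andP; split; lra.
  move=> x hx.
  have x2 : `|x| <= 2 by rewrite ler_norml; case/andP: hx => h1 h2; apply/andP.
  (* phi is the error of the linear approximation in the parameter; its derivative is O(d). *)
  pose phi y := x ^+ k * (1 + y * x) `^ c - y * (c * x ^+ k.+1 * (1 + a * x) `^ (c - 1)).
  pose dphi y := c * x ^+ k.+1 * ((1 + y * x) `^ (c - 1) - (1 + a * x) `^ (c - 1)).
  have in4 y : a <= y <= a + d -> 0 <= y <= 1 / 4 by move=> /andP[h1 h2]; apply/andP; split; lra.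
  have a14 : 0 <= a <= 1 / 4 by apply/andP; split; lra.
  have ad : a <= a + d by lra.
  have := @le_MVT R phi dphi (`|c| * (L * d)) a (a + d) ad.
  have -> : a + d - a = d by ring.
  move=> H.
  have {H} : `|phi (a + d) - phi a| <= `|c| * (L * d) * d.
    apply: H => y hy.
    + have /andP[h _] := affine_bounds y x (in4 y hy) hx.
      have D : is_derive y 1 (fun y => (1 + y * x) `^ c) (c * x * (1 + y * x) `^ (c - 1)).
        rewrite (_ : (fun y => _) = (fun y => (1 + x * y) `^ c)); last first.
          by apply/funext => z; rewrite mulrC.
        by rewrite (mulrC y); apply: is_derive_affine_powR; rewrite mulrC; lra.
      by apply: is_derive_eq; rewrite /dphi /GRing.scale/= exprS; ring.
    + rewrite /dphi !normrM -mulrA ler_wpM2l//.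
      have h := powR_lipschitz (c - 1) a y x a14 (in4 y hy) hx.
      rewrite /L -mulrA; apply: ler_pM => //.
        by rewrite normrX; apply: lerXn2r; rewrite ?nnegrE.
      apply: le_trans h _; rewrite ler_wpM2l ?mulr_ge0 ?powR_ge0//.
      by rewrite ler_norml; case/andP: hy => h1 h2; apply/andP; split; lra.
  have -> : x ^+ k.+1 * (1 + a * x) `^ (e - k.+1%:R) - g x =
     - (d * c)^-1 * (phi (a + d) - phi a).
    rewrite (_ : e - k.+1%:R = c - 1); last by rewrite /c -natr1; ring.
    by rewrite /phi /g; field; rewrite c0 gt_eqF.
  move=> H; rewrite normrM normrN normfV normrM (ger0_norm (ltW d0)).
  rewrite mulrC ler_pdivrMr ?mulr_gt0//; apply: le_trans H _.
  have L1 : 0 < L + 1 by lra.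
  have : L * d <= eta by move: d2; rewrite ler_pdivlMr//; lra.
  move=> h; rewrite (_ : _ * d = L * d * (d * `|c|)); last by ring.
  by rewrite ler_wpM2r// mulr_ge0// ltW.
Qed.

(** At a = 0 the previous lemma gives the monomials. *)
Lemma approximable_continuous {R : realType} (e : R) (f : R -> R) : e < 0 ->
  continuous f -> approximable e f.
Proof.
move=> e0 cf; apply: approximable_lim => eta eta0.
have m22 : -2 < 2 :> R by lra.
have [p hp] := weierstrass f (-2) 2 eta m22 cf eta0.
exists (fun x => p.[x]) => //.
have -> : (fun x => p.[x]) = (fun x => \sum_(i < size p) p`_i * x ^+ i).
  by apply/funext => x; rewrite horner_coef.
elim: (size p) => [|n IH].
  rewrite (_ : (fun x => _) = (fun=> 0)); first exact: approximable0.
  by apply/funext => x; rewrite big_ord0.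
rewrite (_ : (fun x => _) = (fun x => \sum_(i < n) p`_i * x ^+ i + p`_n * x ^+ n)).
  apply: approximableD => //; apply: approximableZ.
  rewrite (_ : (fun x => _) = (fun x => x ^+ n * (1 + 0 * x) `^ (e - n%:R))).
    by apply: approximable_monomial => //; apply/andP; split; lra.
  by apply/funext => x; rewrite mul0r addr0 powR1 mulr1.
by apply/funext => x; rewrite big_ord_recr.
Qed.

(** * Density in C^2 of the powers of affine functions *)

(** The coefficients of the derivative of a sum of powers, which is again a sum
    of powers with exponent e - 1. *)
Definition powers_derive {R : realType} (e : R) (l : seq (R * R)) : seq (R * R) :=
  [seq (p.1 * (e * p.2), p.2) | p <- l].

Lemma slow_powers_derive {R : realType} (e : R) (l : seq (R * R)) :
  slow (powers_derive e l) = slow l.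
Proof. by rewrite /slow all_map. Qed.

Lemma is_derive_powers_sum {R : realType} (e x : R) (l : seq (R * R)) :
  slow l -> -2 <= x <= 2 ->
  is_derive x 1 (powers_sum e l) (powers_sum (e - 1) (powers_derive e l) x).
Proof.
move=> + hx; elim: l => [_|[c a] l IH] /=.
  rewrite (_ : powers_sum e [::] = fun=> 0); last by apply/funext => y; rewrite /powers_sum big_nil.
  by rewrite /powers_sum big_nil; exact: is_derive_cst.
move=> /andP[/andP[a0 a1] sl].
have ha : 0 <= a <= 1 / 4 by rewrite (ltW a0).
have /andP[h _] := affine_bounds a x ha hx.
rewrite (_ : powers_sum e ((c, a) :: l) = fun y => c * (1 + a * y) `^ e + powers_sum e l y); last first.
  by apply/funext => y; rewrite /powers_sum big_cons.
have d1 : is_derive x 1 (fun y => (1 + a * y) `^ e) (e * a * (1 + a * x) `^ (e - 1)).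
  by apply: is_derive_affine_powR; lra.
have d2 := IH sl.
have -> : powers_sum (e - 1) (powers_derive e ((c, a) :: l)) x =
    c * (e * a * (1 + a * x) `^ (e - 1)) + powers_sum (e - 1) (powers_derive e l) x.
  by rewrite /powers_sum big_cons /=; ring.
exact: (is_deriveD (is_deriveZ c d1) d2).
Qed.

(** It suffices to approximate the second derivative uniformly while matching
    the value and the slope at 0, since the errors on the function and on its
    derivative then follow by integration.  The second derivative of a sum of
    powers s is an arbitrary sum of powers s - 2. *)
Lemma C2_density {R : realType} (s : R) (g g1 g2 : R -> R) (eta : R) :
  0 < s -> s < 1 -> 0 < eta ->
  (forall x : R, -2 < x < 2 -> is_derive x 1 g (g1 x)) ->
  (forall x : R, -2 < x < 2 -> is_derive x 1 g1 (g2 x)) -> continuous g2 ->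
  exists2 l, slow l & forall x, -2 < x < 2 ->
    [/\ `|g x - powers_sum s l x| <= eta,
        `|g1 x - powers_sum (s - 1) (powers_derive s l) x| <= eta &
        `|g2 x - powers_sum (s - 1 - 1) (powers_derive (s - 1) (powers_derive s l)) x| <= eta].
Proof.
move=> s0 s1 eta0 dg dg1 cg2.
have n8 : 0 < eta / 8 by lra.
have em : s - 1 - 1 < 0 by lra.
have [l0 sl0 hl0] := approximable_continuous _ g2 em cg2 _ n8.
(* The coefficients are divided so that the second derivative is the sum given by l0. *)
pose l1 := [seq (p.1 / (s * (s - 1) * p.2 ^+ 2), p.2) | p <- l0].
have sl1 : slow l1 by rewrite /slow all_map.
have l1E : powers_derive (s - 1) (powers_derive s l1) = l0.
  rewrite /powers_derive /l1 -!map_comp -[RHS]map_id; apply/eq_in_map => -[c a] /=.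
  move=> /(allP sl0)/= /andP[a0 _]; congr pair; field.
  have sm : s - 1 < 0 by lra.
  by rewrite (gt_eqF a0) (gt_eqF s0) (lt_eqF sm).
pose b0 := g 0 - powers_sum s l1 0.
pose b1 := g1 0 - powers_sum (s - 1) (powers_derive s l1) 0.
pose K := 2 * `|b0| + `|b1| / s.
have K0 : 0 <= K by apply: addr_ge0; [exact: mulr_ge0|apply: divr_ge0 => //; exact: ltW].
pose P : R := 2 `^ `|s - 1 - 1|.
have P0 : 0 <= P by exact: powR_ge0.
pose b := Num.min (1 / 8) (eta / 8 / (5 * K * P + 1)).
have KP : 0 < 5 * K * P + 1 by rewrite ltr_wpDl// !mulr_ge0.
have bp : 0 < b by rewrite lt_min; apply/andP; split; [lra|exact: divr_gt0].
have b8 : b <= 1 / 8 by rewrite ge_min lexx.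
have bK : b * (5 * K * P) <= eta / 8.
  have : b <= eta / 8 / (5 * K * P + 1) by rewrite ge_min lexx orbT.
  by rewrite ler_pdivlMr//; lra.
(* c1 (1 + b x)^s + c2 (1 + 2 b x)^s has value b0 and slope b1 at 0, and its
   second derivative is O(b), so that it tends to the affine function
   b0 + b1 x when b tends to 0. *)
pose c1 := 2 * b0 - b1 / (s * b).
pose c2 := b1 / (s * b) - b0.
pose l2 := [:: (c1, b); (c2, 2 * b)].
have sl2 : slow l2 by rewrite /slow /= andbT; apply/andP; split; apply/andP; split; lra.
have sl : slow (l1 ++ l2) by rewrite /slow all_cat; apply/andP.
exists (l1 ++ l2) => //.
set w := powers_sum s _; set w1 := powers_sum (s - 1) _; set w2 := powers_sum (s - 1 - 1) _.
have w0E : w 0 = g 0.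
  rewrite /w powers_sum_cat {2}/powers_sum big_cons big_seq1 /= !mulr0 !addr0 !powR1.
  by rewrite /c1 /c2 /b0; ring.
have w10E : w1 0 = g1 0.
  rewrite /w1 /powers_derive map_cat powers_sum_cat {2}/powers_sum /= big_cons big_seq1 /=.
  rewrite !mulr0 !addr0 !powR1 -/(powers_derive s l1).
  rewrite (_ : _ + (_ + _) = powers_sum (s - 1) (powers_derive s l1) 0 + b1).
    by rewrite /b1; ring.
  by congr (_ + _); rewrite /c1 /c2; field; rewrite !gt_eqF.
have dw (x : R) : -2 < x < 2 -> is_derive x 1 w (w1 x).
  by move=> /andP[h1 h2]; apply: is_derive_powers_sum => //; rewrite !ltW.
have dw1 (x : R) : -2 < x < 2 -> is_derive x 1 w1 (w2 x).
  move=> /andP[h1 h2]; apply: is_derive_powers_sum; last by rewrite !ltW.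
  by rewrite slow_powers_derive.
have hw2 (x : R) : -2 < x < 2 -> `|g2 x - w2 x| <= eta / 4.
  move=> /andP[h1 h2]; have hx : -2 <= x <= 2 by rewrite !ltW.
  rewrite /w2 /powers_derive !map_cat powers_sum_cat -/(powers_derive s l1)
    -/(powers_derive (s - 1) (powers_derive s l1)) l1E.
  rewrite opprD addrA; apply: le_trans (ler_normB _ _) _.
  have -> : eta / 4 = eta / 8 + eta / 8 by field.
  apply: lerD; first exact: hl0.
  rewrite /powers_sum /= big_cons big_seq1 /=.
  have i1 : 0 <= b <= 1 / 4 by clear - bp b8; apply/andP; split; lra.
  have i2 : 0 <= 2 * b <= 1 / 4 by clear - bp b8; apply/andP; split; lra.
  have q1 := powR_le_near1 _ (s - 1 - 1) (affine_bounds b x i1 hx).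
  have q2 := powR_le_near1 _ (s - 1 - 1) (affine_bounds (2 * b) x i2 hx).
  have r1 := powR_ge0 (1 + b * x) (s - 1 - 1).
  have r2 := powR_ge0 (1 + 2 * b * x) (s - 1 - 1).
  have ss : `|s * (s - 1)| <= 1.
    by clear - s0 s1; rewrite ler_norml; apply/andP; split; nra.
  have cb : `|c1 * b| <= K /\ `|c2 * b| <= K.
    have E1 : c1 * b = 2 * b * b0 - b1 / s by rewrite /c1; field; rewrite !gt_eqF.
    have E2 : c2 * b = b1 / s - b * b0 by rewrite /c2; field; rewrite !gt_eqF.
    have nb : `|b1 / s| = `|b1| / s by rewrite normrM (@ger0_norm _ s^-1)// invr_ge0 ltW.
    have n0 : 0 <= `|b0| by [].
    have bb : b <= 1 by clear - b8; lra.
    have b2 : 2 * b <= 2 by clear - b8; lra.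
    have b20 : 0 <= 2 * b by clear - bp; lra.
    rewrite E1 E2 /K; split; apply: le_trans (ler_normB _ _) _; rewrite nb.
      by rewrite lerD2r normrM (ger0_norm b20) ler_wpM2r.
    by rewrite addrC lerD2r normrM (gtr0_norm bp) ler_wpM2r//; clear - bb; lra.
  have [cb1 cb2] := cb.
  set p1 := (1 + b * x) `^ _ in q1 r1 *; set p2 := (1 + 2 * b * x) `^ _ in q2 r2 *.
  rewrite (_ : _ + _ = s * (s - 1) * (b * (c1 * b * p1 + 4 * (c2 * b * p2)))); last by ring.
  rewrite normrM; apply: le_trans (_ : b * (5 * K * P) <= _); last exact: bK.
  apply: le_trans (_ : `|b * (c1 * b * p1 + 4 * (c2 * b * p2))| <= _).
    by apply: ler_piMl.
  rewrite normrM (gtr0_norm bp) ler_wpM2l ?(ltW bp)//.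
  apply: le_trans (ler_normD _ _) _.
  rewrite (_ : 5 * K * P = K * P + 4 * (K * P)); last by ring.
  apply: lerD; first by rewrite normrM (ger0_norm r1); apply: ler_pM.
  by rewrite normrM (@ger0_norm _ 4)// ler_wpM2l// normrM (ger0_norm r2); apply: ler_pM.
have dgw (x : R) : -2 < x < 2 -> is_derive x 1 (fun x => g x - w x) (g1 x - w1 x).
  by move=> hx; have d1 := dg x hx; have d2 := dw x hx; exact: (is_deriveB d1 d2).
have dgw1 (x : R) : -2 < x < 2 -> is_derive x 1 (fun x => g1 x - w1 x) (g2 x - w2 x).
  by move=> hx; have d1 := dg1 x hx; have d2 := dw1 x hx; exact: (is_deriveB d1 d2).
have z0 : g 0 - w 0 = 0 by rewrite w0E subrr.
have z1 : g1 0 - w1 0 = 0 by rewrite w10E subrr.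
move=> x hx.
have x2 : `|x| <= 2 by rewrite ler_norml; case/andP: hx => h1 h2; rewrite !ltW.
have n0 : 0 <= `|x| by [].
split.
- apply: le_trans (le_norm_from0_2 _ _ _ 2 (eta / 4) x dgw dgw1 hw2 z0 z1 hx) _.
  have x4 : x ^+ 2 <= 4 by case/andP: hx => h1 h2; nra.
  by apply: le_trans (_ : eta / 4 * 4 <= _); [rewrite ler_wpM2l//; lra|lra].
- apply: le_trans (le_norm_from0 _ _ 2 (eta / 4) x dgw1 hw2 z1 hx) _.
  by apply: le_trans (_ : eta / 4 * 2 <= _); [rewrite ler_wpM2l//; lra|lra].
- by apply: le_trans (hw2 x hx) _; lra.
Qed.

(** * Functions with given first and second derivatives *)

(** At 0 the function is O(h^2), so its derivative vanishes. *)
Lemma is_derive_max0_exp {R : realType} (n : nat) (t : R) :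
  is_derive t 1 (fun y : R => Num.max 0 y ^+ n.+2) (n.+2%:R * Num.max 0 t ^+ n.+1).
Proof.
have [t0|t0|->] := ltgtP t 0.
- rewrite expr0n mulr0.
  apply: (@near_eq_is_derive _ _ _ (fun=> 0 : R)).
  near=> y; rewrite max_l ?expr0n//; near: y; exact: lt_le_nbhsl.
- apply: (@near_eq_is_derive _ _ _ (fun y : R => y ^+ n.+2)).
    near=> y; rewrite max_r//; near: y; exact: lt_le_nbhsr.
  have d := is_deriveX n.+2 (is_derive_id t (1 : R)).
  rewrite (_ : (fun y : R => y ^+ n.+2) = id ^+ n.+2); last by apply/funext => y; rewrite exprfctE.
  by apply: (is_derive_eq d); rewrite /GRing.scale/= mulr1.
- rewrite expr0n mulr0.
  have lim : h^-1 *: (((fun y : R => Num.max 0 y ^+ n.+2) \o shift 0) (h *: 1) -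
      Num.max 0 0 ^+ n.+2) @[h --> (0 : R)^'] --> (0 : R).
    apply/cvgrPdist_le => e e0; near=> h.
    have h0 : h != 0 by near: h; exact: nbhs_dnbhs_neq.
    have he : `|h| <= e by near: h; apply: dnbhs0_le.
    have h1 : `|h| <= 1 by near: h; apply: dnbhs0_le.
    rewrite sub0r normrN /= addr0 [h *: 1]mulr1 maxxx expr0n subr0.
    have np : 0 < `|h| by rewrite normr_gt0.
    have m0 : 0 <= Num.max 0 h by rewrite le_max lexx.
    have mh : Num.max 0 h <= `|h| by rewrite ge_max normr_ge0 ler_norm.
    rewrite normrM normfV mulrC ler_pdivrMr// ger0_norm ?exprn_ge0//.
    apply: le_trans (_ : `|h| ^+ n.+2 <= _); first by apply: lerXn2r; rewrite ?nnegrE.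
    rewrite exprSr ler_wpM2r// exprS.
    by apply: le_trans he; rewrite ler_piMr// exprn_ile1.
  split; first by apply/cvg_ex; exists 0.
  exact: (cvg_lim _ lim).
Unshelve. all: by end_near. Qed.

Lemma is_derive_max0_affine {R : realType} (n : nat) (a b x : R) :
  is_derive x 1 (fun y : R => Num.max 0 (b + a * y) ^+ n.+2)
    (a * n.+2%:R * Num.max 0 (b + a * x) ^+ n.+1).
Proof.
have d := @is_derive1_comp R (fun y : R => Num.max 0 y ^+ n.+2) (fun y => b + a * y) x _ _
  (is_derive_max0_exp n _) (is_derive_affine b a x).
by apply: (is_derive_eq d); ring.
Qed.

(** The derivatives are explicit functions, so that sums and products can be
    computed; C2_data_derive links them with the iterated derivatives of f. *)
Definition C2_data {R : realType} (a b : R) (f f1 f2 : R -> R) : Prop :=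
  forall x, a < x < b ->
    [/\ is_derive x 1 f (f1 x), is_derive x 1 f1 (f2 x) & {for x, continuous f2}].

Lemma C2_dataD {R : realType} (a b : R) (f f1 f2 g g1 g2 : R -> R) :
  C2_data a b f f1 f2 -> C2_data a b g g1 g2 ->
  C2_data a b (fun x => f x + g x) (fun x => f1 x + g1 x) (fun x => f2 x + g2 x).
Proof.
move=> F G x hx; have [? ? ?] := F x hx; have [? ? ?] := G x hx.
by split; [exact: is_deriveD|exact: is_deriveD|exact: continuousD].
Qed.

Lemma C2_dataZ {R : realType} (a b c : R) (f f1 f2 : R -> R) :
  C2_data a b f f1 f2 ->
  C2_data a b (fun x => c * f x) (fun x => c * f1 x) (fun x => c * f2 x).
Proof.
move=> F x hx; have [d1 d2 ?] := F x hx.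
split; [exact: (is_deriveZ c d1)|exact: (is_deriveZ c d2)|].
by apply: continuousM => //; exact: cst_continuous.
Qed.

Lemma C2_dataM {R : realType} (a b : R) (f f1 f2 g g1 g2 : R -> R) :
  C2_data a b f f1 f2 -> C2_data a b g g1 g2 ->
  C2_data a b (fun x => f x * g x) (fun x => f1 x * g x + f x * g1 x)
    (fun x => f2 x * g x + 2 * (f1 x * g1 x) + f x * g2 x).
Proof.
move=> F G x hx; have [df df1 cf2] := F x hx; have [dg dg1 cg2] := G x hx.
split.
- by apply: (is_derive_eq (is_deriveM df dg)); rewrite /GRing.scale/=; ring.
- apply: (is_derive_eq (is_deriveD (is_deriveM df1 dg) (is_deriveM df dg1))).
  by rewrite /GRing.scale/=; ring.
- have cf := is_derive_continuous _ _ _ df; have cf1 := is_derive_continuous _ _ _ df1.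
  have cg := is_derive_continuous _ _ _ dg; have cg1 := is_derive_continuous _ _ _ dg1.
  apply: (@continuousD _ _ _ (fun x => f2 x * g x + 2 * (f1 x * g1 x)) (fun x => f x * g2 x));
    last exact: continuousM.
  apply: (@continuousD _ _ _ (fun x => f2 x * g x) (fun x => 2 * (f1 x * g1 x)));
    first exact: continuousM.
  apply: (@continuousM _ _ (fun=> 2 : R) (fun x => f1 x * g1 x)); first exact: cst_continuous.
  exact: continuousM.
Qed.

Lemma C2_dataW {R : realType} (a b c d : R) (f f1 f2 : R -> R) : c <= a -> b <= d ->
  C2_data c d f f1 f2 -> C2_data a b f f1 f2.
Proof. by move=> ca bd F x /andP[ax xb]; apply: F; apply/andP; split; lra. Qed.

Lemma C2_data_max0 {R : realType} (c d a b : R) : C2_data c d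
  (fun x : R => Num.max 0 (b + a * x) ^+ 3)
  (fun x : R => a * 3 * Num.max 0 (b + a * x) ^+ 2)
  (fun x : R => a * 3 * (a * 2 * Num.max 0 (b + a * x))).
Proof.
move=> x _; split.
- exact: is_derive_max0_affine.
- have d2 := is_derive_max0_affine 0 a b x; rewrite expr1 in d2.
  exact: (is_deriveZ (a * 3) d2).
- apply: (@continuousM _ _ (fun=> a * 3) (fun x => a * 2 * Num.max 0 (b + a * x)));
    first exact: cst_continuous.
  apply: (@continuousM _ _ (fun=> a * 2) (fun x => Num.max 0 (b + a * x)));
    first exact: cst_continuous.
  apply: (@continuous_max _ _ (fun=> 0) (fun x => b + a * x)); first exact: cst_continuous.
  exact: is_derive_continuous (is_derive_affine b a x).
Qed.

Lemma C2_data_derive {R : realType} (a b : R) (f f1 f2 : R -> R) (x : R) :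
  C2_data a b f f1 f2 -> a < x < b ->
  [/\ f^`(1)%classic x = f1 x, f^`(2)%classic x = f2 x,
      (forall i, (i < 2)%N -> derivable f^`(i)%classic x 1) &
      forall i, (i <= 2)%N -> {for x, continuous f^`(i)%classic}].
Proof.
move=> F hx.
have near_ab y : a < y < b -> \forall z \near y, a < z < b.
  move=> /andP[ay yb]; near=> z; apply/andP; split; near: z;
    [exact: lt_nbhsr|exact: lt_nbhsl].
have E1 y : a < y < b -> f^`(1)%classic y = f1 y.
  by move=> /F[[_ <-] _ _]; rewrite derive1n1 derive1E.
have N1 y : a < y < b -> \forall z \near y, f1 z = f^`(1)%classic z.
  by move=> hy; near=> z; rewrite E1//; near: z; exact: near_ab.
have D2 y : a < y < b -> is_derive y 1 f^`(1)%classic (f2 y).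
  move=> hy; have [_ d _] := F y hy.
  by apply: near_eq_is_derive d; exact: N1.
have E2 y : a < y < b -> f^`(2)%classic y = f2 y.
  by move=> hy; rewrite derive1nS derive1E; have [_ ->] := D2 y hy.
have [d0 d1 c2] := F x hx.
split; [exact: E1|exact: E2| |].
- by move=> [|[|//]] _; [case: d0|case: (D2 x hx)].
- move=> [|[|[|//]]] _; [exact: is_derive_continuous d0|exact: is_derive_continuous (D2 x hx)|].
  suff : f^`(2)%classic @ x --> f^`(2)%classic x by [].
  rewrite (E2 x hx); apply: cvg_trans c2.
  by apply: near_eq_cvg; near=> z; rewrite E2//; near: z; exact: near_ab.
Unshelve. all: by end_near. Qed.

(** * Sums of torsion functions *)

Lemma C2_data_powers_sum {R : realType} (s : R) (l : seq (R * R)) : slow l ->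
  C2_data (-2) 2 (powers_sum s l) (powers_sum (s - 1) (powers_derive s l))
    (powers_sum (s - 1 - 1) (powers_derive (s - 1) (powers_derive s l))).
Proof.
move=> sl x /andP[h1 h2]; have hx : -2 <= x <= 2 by rewrite !ltW.
split.
- exact: is_derive_powers_sum.
- by apply: is_derive_powers_sum; rewrite ?slow_powers_derive.
- by apply: is_derive_continuous; apply: is_derive_powers_sum; rewrite ?slow_powers_derive.
Qed.

Lemma powers_sum_bounded {R : realType} (e : R) (l : seq (R * R)) : slow l ->
  exists2 M : R, 0 <= M & forall x : R, -2 <= x <= 2 -> `|powers_sum e l x| <= M.
Proof.
elim: l => [_|[c a] l IH] /=.
  by exists 0 => // x _; rewrite /powers_sum big_nil normr0.
move=> /andP[/andP[a0 a1] sl]; have [M M0 hM] := IH sl.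
exists (`|c| * 2 `^ `|e| + M); first by rewrite addr_ge0// mulr_ge0// powR_ge0.
move=> x hx; rewrite /powers_sum big_cons /=; apply: le_trans (ler_normD _ _) _.
apply: lerD; last exact: hM.
have ha : 0 <= a <= 1 / 4 by rewrite (ltW a0).
rewrite normrM ler_wpM2l// (ger0_norm (powR_ge0 _ _)).
exact: powR_le_near1 (affine_bounds a x ha hx).
Qed.

Lemma C2_data_cutoff {R : realType} (s g : R) : 0 <= g <= 1 / 4 ->
  C2_data (-2) 2 (fun y => (1 - g * y) `^ s) (fun y => s * - g * (1 - g * y) `^ (s - 1))
    (fun y => s * - g * ((s - 1) * - g * (1 - g * y) `^ (s - 1 - 1))).
Proof.
move=> /andP[g0 g1] x /andP[h1 h2].
have p : 0 < 1 + - g * x by nra.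
have E e : (fun y => (1 - g * y) `^ e) = (fun y => (1 + - g * y) `^ e).
  by apply/funext => y; rewrite mulNr.
have D e : is_derive x 1 (fun y => (1 - g * y) `^ e) (e * - g * (1 - g * x) `^ (e - 1)).
  by rewrite E -[- (g * x)]mulNr; exact: is_derive_affine_powR.
split; first exact: D.
- exact: (is_deriveZ (s * - g) (D (s - 1))).
- apply: is_derive_continuous (is_deriveZ (s * - g) (is_deriveZ ((s - 1) * - g) (D (s - 1 - 1)))).
Qed.

(** In C^2, the factor (1 - g y)^s tends to 1 linearly in g. *)
Lemma cutoff_bounds {R : realType} (s g x : R) : 0 < s -> s < 1 -> 0 <= g <= 1 / 4 ->
  -2 <= x <= 2 ->
  [/\ `|(1 - g * x) `^ s - 1| <= 4 * g,
      `|s * - g * (1 - g * x) `^ (s - 1)| <= 4 * g &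
      `|s * - g * ((s - 1) * - g * (1 - g * x) `^ (s - 1 - 1))| <= 4 * g].
Proof.
move=> s0 s1 hg hx.
have hx' : -2 <= - x <= 2 by case/andP: hx => h1 h2; apply/andP; split; lra.
have w := affine_bounds g (- x) hg hx'; rewrite mulrN in w.
have /andP[g0 g1] := hg.
have pow2 (k : nat) (e : R) : `|e| <= k%:R -> (1 - g * x) `^ e <= 2 ^+ k.
  move=> ek; apply: le_trans (powR_le_near1 _ e w) _.
  by rewrite -powR_mulrn// ler_powR// ler1n.
have q1 : (1 - g * x) `^ (s - 1) <= 2.
  by apply: (pow2 1%N); rewrite ler_norml; apply/andP; split; lra.
have q2 : (1 - g * x) `^ (s - 1 - 1) <= 4.
  have -> : 4 = 2 ^+ 2 :> R by ring.
  by apply: (pow2 2%N); rewrite ler_norml; apply/andP; split; lra.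
have r1 := powR_ge0 (1 - g * x) (s - 1).
have r2 := powR_ge0 (1 - g * x) (s - 1 - 1).
split.
- rewrite distrC; apply: le_trans (dist1_powR _ _ s0 s1 _) _.
    by case/andP: w => w1 w2; lra.
  rewrite subKr normrM (ger0_norm g0) mulrC ler_wpM2r//.
  by apply: le_trans (_ : 2 <= _); [rewrite ler_norml|lra].
- rewrite !normrM normrN (gtr0_norm s0) (ger0_norm g0) (ger0_norm r1).
  apply: le_trans (_ : 1 * g * 4 <= _); last by lra.
  apply: ler_pM; rewrite ?mulr_ge0 ?(ltW s0)//; last by lra.
  by rewrite ler_wpM2r// ltW.
- rewrite !normrM normrN (gtr0_norm s0) (ger0_norm g0) (ger0_norm r2).
  have s1' : `|s - 1| <= 1 by rewrite ler_norml; apply/andP; split; lra.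
  apply: le_trans (_ : (1 * g) * ((1 * 1) * 4) <= _); last by lra.
  apply: ler_pM; rewrite ?mulr_ge0 ?(ltW s0)//; first by rewrite ler_wpM2r// ltW.
  apply: ler_pM; rewrite ?mulr_ge0//.
  by apply: ler_pM => //; lra.
Qed.

Definition torsion_sum {R : realType} (s g : R) (l : seq (R * R)) (y : R) : R :=
  \sum_(p <- l) p.1 * torsion s p.2 g y.

(** On [-2, 2] no positive part is active, and the factor (1 - g x)^s is common. *)
Lemma torsion_sumE {R : realType} (s g x : R) (l : seq (R * R)) : slow l ->
  0 <= g <= 1 / 4 -> -2 <= x <= 2 ->
  torsion_sum s g l x = powers_sum s l x * (1 - g * x) `^ s.
Proof.
move=> sl hg hx; rewrite /torsion_sum /powers_sum mulr_suml.
have hx' : -2 <= - x <= 2 by case/andP: hx => h1 h2; apply/andP; split; lra.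
have /andP[w _] := affine_bounds g (- x) hg hx'; rewrite mulrN in w.
have w0 : 0 <= 1 - g * x by lra.
apply: eq_big_seq => -[c a] /(allP sl)/= /andP[a0 a1].
have ha : 0 <= a <= 1 / 4 by rewrite (ltW a0).
have /andP[u _] := affine_bounds a x ha hx.
have u0 : 0 <= 1 + a * x by lra.
by rewrite -mulrA -powRM// /torsion max_r// mulr_ge0.
Qed.

Lemma continuous_torsion_sum {R : realType} (s g : R) (l : seq (R * R)) : 0 < s ->
  continuous (torsion_sum s g l).
Proof.
move=> s0; elim: l => [|[c a] l IH] x.
  rewrite (_ : torsion_sum s g [::] = fun=> 0); first exact: cst_continuous.
  by apply/funext => y; rewrite /torsion_sum big_nil.
rewrite (_ : torsion_sum s g _ = fun y => c * torsion s a g y + torsion_sum s g l y).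
  apply: (@continuousD _ _ _ (fun y => c * torsion s a g y) (torsion_sum s g l)); last exact: IH.
  apply: (@continuousM _ _ (fun=> c) (torsion s a g)); first exact: cst_continuous.
  exact: continuous_torsion.
by apply/funext => y; rewrite /torsion_sum big_cons.
Qed.

Lemma torsion_sum_support {R : realType} (s g : R) (l : seq (R * R)) : 0 < s ->
  0 < g -> slow l -> exists2 B : R, 0 <= B & forall y : R, B <= `|y| -> torsion_sum s g l y = 0.
Proof.
move=> s0 g0; elim: l => [_|[c a] l IH] /=.
  by exists 0 => // y _; rewrite /torsion_sum big_nil.
move=> /andP[/andP[a0 a1] sl]; have [B B0 hB] := IH sl.
have ai : 0 < a^-1 by rewrite invr_gt0.
have gi : 0 < g^-1 by rewrite invr_gt0.
exists (B + a^-1 + g^-1); first by lra.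
move=> y hy; rewrite /torsion_sum big_cons /= -/(torsion_sum s g l y) hB; last by lra.
rewrite addr0 /torsion max_l ?powR0 ?mulr0 ?gt_eqF//.
have [y0|y0] := leP 0 y.
  have gy : 1 <= g * y.
    by rewrite mulrC -ler_pdivrMr// mul1r; move: hy; rewrite ger0_norm//; lra.
  by rewrite mulr_ge0_le0//; [rewrite addr_ge0// mulr_ge0// ltW|lra].
have ay : 1 <= a * - y.
  by rewrite mulrC -ler_pdivrMr// mul1r; move: hy; rewrite ltr0_norm//; lra.
have gy : g * y <= 0 by apply: mulr_ge0_le0; exact: ltW.
by apply: mulr_le0_ge0; lra.
Qed.

(** The Laplacian is a constant, proportional to g^s and to a linear form in the
    coefficients. *)
Lemma torsion_sum_laplacian {R : realType} (s kappa g x : R) (l : seq (R * R)) :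
  (forall a g x : R, 0 < a -> 0 < g -> 0 < 1 + a * x -> 0 < 1 - g * x ->
    frac_laplacian_eq s (torsion s a g) x (kappa * (a * g) `^ s)) ->
  slow l -> 0 < g <= 1 / 4 -> -2 <= x <= 2 ->
  frac_laplacian_eq s (torsion_sum s g l) x
    (kappa * g `^ s * \sum_(p <- l) p.1 * p.2 `^ s).
Proof.
move=> K + /andP[g0 g1] hx.
have hg : 0 <= g <= 1 / 4 by rewrite (ltW g0).
have hx' : -2 <= - x <= 2 by case/andP: hx => h1 h2; apply/andP; split; lra.
have /andP[w _] := affine_bounds g (- x) hg hx'; rewrite mulrN in w.
have wp : 0 < 1 - g * x by lra.
have one a : 0 < a <= 1 / 4 -> frac_laplacian_eq s (torsion s a g) x (kappa * (a * g) `^ s).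
  move=> /andP[a0 a1]; have ha : 0 <= a <= 1 / 4 by rewrite (ltW a0).
  by have /andP[u _] := affine_bounds a x ha hx; apply: K => //; lra.
elim: l => [_|[c a] l IH] /=.
  rewrite big_nil mulr0.
  have h4 : 0 < (1 / 4 : R) <= 1 / 4 by apply/andP; split; lra.
  have := frac_laplacian_eqZ s x _ 0 _ (one _ h4); rewrite mul0r.
  by congr frac_laplacian_eq; apply/funext => y; rewrite /torsion_sum big_nil mul0r.
move=> /andP[a14 sl]; have /andP[a0 _] := a14.
have := frac_laplacian_eqD s x _ _ _ _ (frac_laplacian_eqZ s x _ c _ (one a a14)) (IH sl).
rewrite big_cons /= powRM ?(ltW a0) ?(ltW g0)//.
rewrite mulrDr (_ : kappa * g `^ s * (c * a `^ s) = c * (kappa * (a `^ s * g `^ s))); last by ring.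
by congr frac_laplacian_eq; apply/funext => y; rewrite /torsion_sum big_cons.
Qed.

Lemma eq_C2_data {R : realType} (a b : R) (f g f1 f2 : R -> R) :
  (forall x, a < x < b -> f x = g x) -> C2_data a b f f1 f2 -> C2_data a b g f1 f2.
Proof.
move=> fg F x hx; have [d0 d1 c2] := F x hx; split => //.
move: hx => /andP[ax xb]; apply: near_eq_is_derive d0; near=> z; apply: fg.
by apply/andP; split; near: z; [exact: lt_nbhsr|exact: lt_nbhsl].
Unshelve. all: by end_near. Qed.

Lemma bounded_support_of {R : realType} (v : R -> R) (B : R) :
  (forall y, B <= `|y| -> v y = 0) -> bounded_support v.
Proof.
move=> hB; rewrite /bounded_support.
have sub : closure [set x | v x != 0] `<=` `[- B, B]%classic.
  apply: (@subset_trans _ (closure `[- B, B]%classic)).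
    apply: closureS => y /= vy; rewrite in_itv/= -ler_norml.
    by rewrite leNgt; apply: contra vy => /ltW/hB ->.
  have /closure_id <- : closed (`[- B, B]%classic : set R) by exact: interval_closed.
  by [].
exists B; split; first exact: num_real.
move=> M BM y /sub /=; rewrite in_itv/= -ler_norml => h.
exact: le_trans h (ltW BM).
Qed.

(** * Density in C^2 of locally s-harmonic functions *)

Lemma product_bounds {R : realType} (A B f f1 f2 g g1 g2 : R) :
  `|f| <= A -> `|f1| <= A -> `|f2| <= A -> `|g| <= B -> `|g1| <= B -> `|g2| <= B ->
  [/\ `|f * g| <= 4 * (A * B), `|f1 * g + f * g1| <= 4 * (A * B) &
      `|f2 * g + 2 * (f1 * g1) + f * g2| <= 4 * (A * B)].
Proof.
move=> a0 a1 a2 b0 b1 b2.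
have le2 (y z : R) : `|y| <= A -> `|z| <= B -> `|y * z| <= A * B.
  by move=> hy hz; rewrite normrM; apply: ler_pM.
have p00 := le2 _ _ a0 b0; have p10 := le2 _ _ a1 b0; have p01 := le2 _ _ a0 b1.
have p20 := le2 _ _ a2 b0; have p11 := le2 _ _ a1 b1; have p02 := le2 _ _ a0 b2.
have AB : 0 <= A * B by exact: le_trans (normr_ge0 _) p00.
split.
- by clear - p00 AB; lra.
- by apply: le_trans (ler_normD _ _) _; clear - p10 p01 AB; lra.
- apply: le_trans (ler_normD _ _) _.
  have h := ler_normD (f2 * g) (2 * (f1 * g1)).
  rewrite [X in _ <= _ + X]normrM (@ger0_norm _ 2)// in h.
  by clear - p20 p11 p02 h; lra.
Qed.

Lemma powers_sum_C2_bounded {R : realType} (s : R) (l : seq (R * R)) : slow l ->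
  exists2 M : R, 0 <= M & forall x : R, -2 <= x <= 2 ->
    [/\ `|powers_sum s l x| <= M, `|powers_sum (s - 1) (powers_derive s l) x| <= M &
        `|powers_sum (s - 1 - 1) (powers_derive (s - 1) (powers_derive s l)) x| <= M].
Proof.
move=> sl.
have sl1 : slow (powers_derive s l) by rewrite slow_powers_derive.
have sl2 : slow (powers_derive (s - 1) (powers_derive s l)) by rewrite slow_powers_derive.
have [M0 M00 hM0] := powers_sum_bounded s l sl.
have [M1 M10 hM1] := powers_sum_bounded (s - 1) _ sl1.
have [M2 M20 hM2] := powers_sum_bounded (s - 1 - 1) _ sl2.
exists (M0 + M1 + M2); first by rewrite !addr_ge0.
move=> x hx; have h0 := hM0 x hx; have h1 := hM1 x hx; have h2 := hM2 x hx.
by split; [apply: le_trans h0 _|apply: le_trans h1 _|apply: le_trans h2 _];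
  clear - M00 M10 M20; lra.
Qed.

(** Take g small: both M g and g^s L tend to 0. *)
Lemma small_cutoff {R : realType} (s M L e : R) : 0 < s -> 0 <= M -> 0 <= L -> 0 < e ->
  exists2 ga : R, 0 < ga <= 1 / 4 & M * ga <= e /\ ga `^ s * L <= e.
Proof.
move=> s0 M0 L0 e0; have L1 : 0 < L + 1 by rewrite ltr_wpDl.
have eL : 0 < e / (L + 1) by rewrite divr_gt0.
have [T T0 hT] := powR_vanish _ _ s0 eL.
have Me : 0 <= M / e by rewrite divr_ge0// ltW.
pose u := T + 4 + M / e.
have uT : T <= u by rewrite /u; lra.
have u4 : 4 <= u by rewrite /u; lra.
have uM : M / e <= u by rewrite /u; lra.
have u0 : 0 < u by lra.
exists u^-1; first by rewrite invr_gt0 u0 -div1r ler_pdivrMr//; lra.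
split; first by rewrite ler_pdivrMr// mulrC -ler_pdivrMr.
rewrite (powR_invl _ _ (ltW u0)).
apply: le_trans (_ : e / (L + 1) * L <= _); first by rewrite ler_wpM2r// hT.
rewrite (_ : _ * L = L / (L + 1) * e); last by ring.
by apply: ler_piMl; [exact: ltW|rewrite ler_pdivrMr// mul1r lerDl].
Qed.

(** Take a sum w of powers close to the target.  The torsion sum with the same
    coefficients is w (1 - g x)^s on [-2, 2]; it is close to w for small g,
    and its Laplacian there is a constant of order g^s.  Adding a multiple
    of order g^s of a fixed torsion function makes the Laplacian vanish. *)
Lemma locally_harmonic_density {R : realType} (s : R) (g g1 g2 : R -> R) (eta : R) :
  0 < s -> s < 1 -> 0 < eta ->
  (forall x : R, -2 < x < 2 -> is_derive x 1 g (g1 x)) ->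
  (forall x : R, -2 < x < 2 -> is_derive x 1 g1 (g2 x)) -> continuous g2 ->
  exists v v1 v2 : R -> R, [/\ C2_data (-2) 2 v v1 v2,
    forall x, -2 < x < 2 ->
      [/\ `|g x - v x| <= eta, `|g1 x - v1 x| <= eta & `|g2 x - v2 x| <= eta],
    continuous v, bounded_support v &
    forall x, -2 < x < 2 -> frac_laplacian_eq s v x 0].
Proof.
move=> s0 s1 eta0 dg dg1 cg2.
have e4 : 0 < eta / 4 by lra.
have [l sl hl] := C2_density s g g1 g2 _ s0 s1 e4 dg dg1 cg2.
have [kappa K] := torsion_laplacian s s0 s1.
have [M M0 hM] := powers_sum_C2_bounded s l sl.
have dw := C2_data_powers_sum s l sl.
set w := powers_sum s l in hl hM dw; set w1 := powers_sum (s - 1) _ in hl hM dw.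
set w2 := powers_sum (s - 1 - 1) _ in hl hM dw.
(* k describes the fixed torsion function, with roots -4 and 4. *)
pose k : seq (R * R) := [:: (1, 1 / 4)].
have sk : slow k by rewrite /slow /= andbT; apply/andP; split; lra.
have [N N0 hN] := powers_sum_C2_bounded s k sk.
have q4' : 0 < (1 / 4 : R) <= 1 / 4 by apply/andP; split; lra.
have q4 : 0 <= (1 / 4 : R) <= 1 / 4 by apply/andP; split; lra.
have dt := C2_dataM _ _ _ _ _ _ _ _ (C2_data_powers_sum s k sk) (C2_data_cutoff s (1 / 4) q4).
set t := (fun x => powers_sum s k x * _) in dt; set t1 := (X in C2_data _ _ t X _) in dt.
set t2 := (X in C2_data _ _ t t1 X) in dt.
have ht (x : R) : -2 <= x <= 2 -> [/\ `|t x| <= 4 * (N * 2), `|t1 x|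
  <= 4 * (N * 2) & `|t2 x| <= 4 * (N * 2)].
  move=> hx; have [b0 b1 b2] := cutoff_bounds s (1 / 4) x s0 s1 q4 hx.
  have [n0 n1 n2] := hN x hx.
  apply: product_bounds => //; last 2 first.
  - by apply: le_trans b1 _; lra.
  - by apply: le_trans b2 _; lra.
  rewrite -[X in `|X| <= _](subrK 1); apply: le_trans (ler_normD _ _) _.
  by rewrite normr1; clear - b0; lra.
pose S := \sum_(p <- l) p.1 * p.2 `^ s.
pose D := (1 / 4 : R) `^ s * (1 / 4) `^ s.
have D0 : 0 < D by rewrite mulr_gt0// powR_gt0//; lra.
have L0 : 0 <= `|S| / D * (4 * (N * 2)).
  by rewrite mulr_ge0 ?divr_ge0 ?(ltW D0)// !mulr_ge0.
have M16 : 0 <= 16 * M by rewrite mulr_ge0.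
have [ga hga' [gaM gaL]] := small_cutoff _ _ _ _ s0 M16 L0 e4.
have hga : 0 <= ga <= 1 / 4 by case/andP: hga' => /ltW -> ->.
have /andP[ga0 _] := hga'.
(* The sum of the two constant Laplacians is kappa (ga^s S + c D). *)
pose c := - (ga `^ s * S / D).
have cN z : `|z| <= 4 * (N * 2) -> `|c * z| <= eta / 4.
  move=> zN; apply: le_trans gaL.
  rewrite normrM /c normrN !normrM normfV (gtr0_norm D0) (ger0_norm (powR_ge0 _ _)).
  by rewrite -!mulrA ler_wpM2l ?powR_ge0// ler_wpM2l// ler_wpM2l// invr_ge0 ltW.
pose v y := torsion_sum s ga l y + c * torsion_sum s (1 / 4) k y.
have dq := C2_data_cutoff s ga hga.
have dv := C2_dataD _ _ _ _ _ _ _ _ (C2_dataM _ _ _ _ _ _ _ _ dw dq) (C2_dataZ _ _ c _ _ _ dt).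
set v1 := (X in C2_data _ _ _ X _) in dv; set v2 := (X in C2_data _ _ _ _ X) in dv.
have vE x : -2 <= x <= 2 -> v x = w x * (1 - ga * x) `^ s + c * t x.
  by move=> hx; rewrite /v !torsion_sumE.
exists v, v1, v2; split.
- by apply: eq_C2_data dv => x /andP[h1 h2]; rewrite vE// !ltW.
- move=> x hx'; have hx : -2 <= x <= 2 by case/andP: hx' => h1 h2; rewrite !ltW.
  have [a0 a1 a2] := hl x hx'; have [n0 n1 n2] := ht x hx.
  have [b0 b1 b2] := cutoff_bounds s ga x s0 s1 hga hx.
  have [m0 m1 m2] := hM x hx.
  rewrite vE// /v1 /v2.
  set q0 := (1 - ga * x) `^ s in b0 *; set q1 := s * - ga * _ in b1 *.
  set q2 := s * - ga * _ in b2 *.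
  have [p0 p1 p2] := product_bounds _ _ _ _ _ _ _ _ m0 m1 m2 b0 b1 b2.
  have p16 : 4 * (M * (4 * ga)) <= eta / 4 by rewrite (_ : _ * _ = 16 * M * ga)//; ring.
  have add3 (A B C : R) : `|A| <= eta / 4 -> `|B| <= 4 * (M * (4 * ga)) -> `|C| <= eta / 4 ->
      `|A - B - C| <= eta.
    move=> hA hB hC; apply: le_trans (ler_normB _ _) _.
    have := ler_normB A B; clear - hA hB hC p16 eta0; lra.
  split.
  + rewrite (_ : _ - _ = (g x - w x) - w x * (q0 - 1) - c * t x); last by ring.
    by apply: add3 => //; exact: cN.
  + rewrite (_ : _ - _ = (g1 x - w1 x) - (w1 x * (q0 - 1) + w x * q1) - c * t1 x); last by ring.
    by apply: add3 => //; exact: cN.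
  + rewrite (_ : _ - _ = (g2 x - w2 x) -
      (w2 x * (q0 - 1) + 2 * (w1 x * q1) + w x * q2) - c * t2 x); last by ring.
    by apply: add3 => //; exact: cN.
- move=> x; apply: (@continuousD _ _ _ (torsion_sum s ga l) (fun y => c * torsion_sum s (1 / 4) k y)).
    exact: continuous_torsion_sum.
  apply: (@continuousM _ _ (fun=> c) (torsion_sum s (1 / 4) k)); first exact: cst_continuous.
  exact: continuous_torsion_sum.
- have [B1 B10 h1] := torsion_sum_support s ga l s0 ga0 sl.
  have q40 : 0 < 1 / 4 :> R by lra.
  have [B2 B20 h2] := torsion_sum_support s (1 / 4) k s0 q40 sk.
  apply: (@bounded_support_of R v (B1 + B2)) => y hy.
  have y1 : B1 <= `|y| by apply: le_trans hy; rewrite lerDl.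
  have y2 : B2 <= `|y| by apply: le_trans hy; rewrite lerDr.
  by rewrite /v h1 ?h2 ?mulr0 ?addr0.
- move=> x /andP[h1 h2]; have hx : -2 <= x <= 2 by rewrite !ltW.
  have H1 := torsion_sum_laplacian s kappa ga x l K sl hga' hx.
  have H2 := torsion_sum_laplacian s kappa (1 / 4) x k K sk q4' hx.
  have := frac_laplacian_eqD s x _ _ _ _ H1 (frac_laplacian_eqZ s x _ c _ H2).
  congr frac_laplacian_eq.
  rewrite big_seq1 /= -/S /c /D.
  set r := (1 / 4) `^ s; have r0 : r != 0 by rewrite gt_eqF// powR_gt0.
  by field.
Qed.

(** * Choice of the endpoints *)

(** Multiples of cubes of positive parts, supported on either side of [-1, 1],
    are C^2 and leave h unchanged on [-1, 1]; on each side, the cubes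
    starting at distances 0 and d give two coefficients to prescribe the slope
    at distances d and 2 d. *)
Lemma turning_points {R : realType} (h h1 h2 : R -> R) (d : R) : 0 < d ->
  (forall a b, C2_data a b h h1 h2) ->
  exists g g1 g2, [/\ forall a b, C2_data a b g g1 g2,
    forall x, -1 <= x <= 1 -> [/\ g x = h x, g1 x = h1 x & g2 x = h2 x],
    g1 (1 + d) = -1, g1 (1 + 2 * d) = 1 &
    g1 (- 1 - d) = -1 /\ g1 (- 1 - 2 * d) = 1].
Proof.
move=> d0 dh.
pose A := (- 1 - h1 (1 + d)) / (3 * d ^+ 2).
pose B := (1 - h1 (1 + 2 * d)) / (3 * d ^+ 2) - 4 * A.
pose A' := - (- 1 - h1 (- 1 - d)) / (3 * d ^+ 2).
pose B' := - (1 - h1 (- 1 - 2 * d)) / (3 * d ^+ 2) - 4 * A'.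
have data a b := C2_dataD _ _ _ _ _ _ _ _
  (C2_dataD _ _ _ _ _ _ _ _ (dh a b)
    (C2_dataD _ _ _ _ _ _ _ _ (C2_dataZ _ _ A _ _ _ (C2_data_max0 a b 1 (- 1)))
      (C2_dataZ _ _ B _ _ _ (C2_data_max0 a b 1 (- 1 - d)))))
  (C2_dataD _ _ _ _ _ _ _ _ (C2_dataZ _ _ A' _ _ _ (C2_data_max0 a b (-1) (- 1)))
    (C2_dataZ _ _ B' _ _ _ (C2_data_max0 a b (-1) (- 1 - d)))).
have mx (b a x y : R) : b + a * x = y -> 0 <= y -> Num.max 0 (b + a * x) = y.
  by move=> -> y0; rewrite max_r.
have m0 (b a x : R) : b + a * x <= 0 -> Num.max 0 (b + a * x) = 0 by exact: max_l.
eexists _, _, _; split; first exact: data.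
- move=> x /andP[x0 x1].
  by rewrite !(@max_l _ _ (0 : R)) ?expr0n/= ?mulr0 ?addr0//; lra.
- rewrite /= (mx (- 1) 1 _ d) ?(m0 (- 1 - d) 1) ?(m0 (- 1) (-1)) ?(m0 (- 1 - d) (-1)); try lra.
  by rewrite /A; field; rewrite gt_eqF.
- rewrite /= (mx (- 1) 1 _ (2 * d)) ?(mx (- 1 - d) 1 _ d) ?(m0 (- 1) (-1))
  ?(m0 (- 1 - d) (-1)); try lra.
  by rewrite /B /A; field; rewrite gt_eqF.
- split.
  + rewrite /= (mx (- 1) (-1) _ d) ?(m0 (- 1 - d) (-1)) ?(m0 (- 1) 1) ?(m0 (- 1 - d) 1); try lra.
    by rewrite /A'; field; rewrite gt_eqF.
  + rewrite /= (mx (- 1) (-1) _ (2 * d)) ?(mx (- 1 - d) (-1) _ d) ?(m0 (- 1) 1)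
    ?(m0 (- 1 - d) 1); try lra.
    by rewrite /B' /A'; field; rewrite gt_eqF.
Qed.

(** Near x the function v is Lipschitz, so the quotient is O(|x - y|^(1 - s)). *)
Lemma frac_normal_derivative_eq0 {R : realType} (s : R) (D : set R) (v v1 : R -> R) (x a b : R) :
  0 < s -> s < 1 -> a < x < b -> (forall y, a < y < b -> is_derive y 1 v (v1 y)) ->
  {for x, continuous v1} -> frac_normal_derivative_eq s D v x 0.
Proof.
move=> s0 s1 /andP[ax xb] dv cv1.
have /cvgrPdist_le/(_ _ ltr01)/nbhs_ballP[r /= r0 hr] := cv1.
pose M := `|v1 x| + 1.
have M0 : 0 < M by rewrite ltr_wpDl.
pose d := Num.min r (Num.min (x - a) (b - x)) / 2.
have d0 : 0 < d by rewrite divr_gt0// !lt_min r0 !subr_gt0 ax.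
have [dr [da db]] : d < r /\ d < x - a /\ d < b - x.
  have h1 : Num.min r (Num.min (x - a) (b - x)) <= r by rewrite ge_min lexx.
  have h2 : Num.min r (Num.min (x - a) (b - x)) <= x - a by rewrite !ge_min lexx orbT.
  have h3 : Num.min r (Num.min (x - a) (b - x)) <= b - x by rewrite !ge_min lexx !orbT.
  by move: d0; rewrite /d => d0; split; [|split]; lra.
have lip y : `|x - y| <= d -> `|v x - v y| <= M * `|x - y|.
  rewrite ler_norml => /andP[y1 y2].
  have in_ab z : x - d <= z <= x + d -> a < z < b /\ `|x - z| < r.
    move=> /andP[z1 z2]; split; first by apply/andP; split; lra.
    by rewrite ltr_norml; apply/andP; split; lra.
  apply: (@le_MVT_norm R v v1 M (x - d) (x + d)).
  - by move=> z /in_ab[zab _]; exact: dv.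
  - move=> z /in_ab[_ /hr h]; rewrite (_ : v1 z = v1 x - (v1 x - v1 z)); last by ring.
    by apply: le_trans (ler_normB _ _) _; rewrite lerD2l; exact: h.
  - by apply/andP; split; lra.
  - by apply/andP; split; lra.
rewrite /frac_normal_derivative_eq; apply/cvgrPdist_le => e e0.
pose q := 1 - s; have q0 : 0 < q by rewrite /q; lra.
have eM : 0 < e / M by rewrite divr_gt0.
have t0 : 0 < (e / M) `^ q^-1 by rewrite powR_gt0.
near=> y.
have yd : `|x - y| <= d.
  apply: ltW; near: y; apply: cvg_within; exact: nbhsx_ballx.
have yt : `|x - y| <= (e / M) `^ q^-1.
  apply: ltW; near: y; apply: cvg_within; exact: nbhsx_ballx.
rewrite sub0r normrN normrM normfV (ger0_norm (powR_ge0 _ _)).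
have [->|xy] := eqVneq x y; first by rewrite !subrr normr0 mul0r ltW.
have n0 : 0 < `|x - y| by rewrite normr_gt0 subr_eq0.
rewrite ler_pdivrMr ?powR_gt0//; apply: le_trans (lip _ yd) _.
have {1}-> : `|x - y| = `|x - y| `^ q * `|x - y| `^ s.
  by rewrite -powRD ?(gt_eqF n0) ?implybT// /q subrK powRr1 ?(ltW n0).
rewrite mulrA ler_wpM2r ?powR_ge0// mulrC -ler_pdivlMr//.
rewrite -[leRHS](powRr1 (ltW eM)) -(mulVf (lt0r_neq0 q0)) powRrM.
by apply: ge0_ler_powR; rewrite ?nnegrE ?(ltW q0) ?(ltW n0) ?powR_ge0.
Unshelve. all: by end_near. Qed.

Lemma normC2_le {R : realType} (a b e : R) (u u1 u2 : R -> R) :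
  C2_data a b u u1 u2 ->
  (forall x, a < x < b -> [/\ `|u x| <= e / 3, `|u1 x| <= e / 3 & `|u2 x| <= e / 3]) ->
  (normC 2 `]a, b[ u <= e%:E)%E.
Proof.
move=> du hu.
have bnd (i : nat) : (i < 3)%N ->
    (ereal_sup [set (`|u^`(i)%classic x|)%:E | x in `]a, b[] <= (e / 3)%:E)%E.
  move=> i3; apply: ge_ereal_sup => _ [x /= + <-]; rewrite in_itv/= => hx.
  rewrite lee_fin; have [D1 D2 _ _] := C2_data_derive _ _ _ _ _ _ du hx.
  have [b0 b1 b2] := hu x hx.
  by case: i i3 => [|[|[|//]]] _; [exact: b0|rewrite D1|rewrite D2].
rewrite /normC !big_ord_recl big_ord0 adde0.
have -> : e%:E = ((e / 3)%:E + ((e / 3)%:E + (e / 3)%:E))%E.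
  by rewrite -!EFinD; congr EFin; field.
by apply: leeD; [exact: bnd|apply: leeD; exact: bnd].
Qed.

Theorem mainTheorem7 (R : realType) (s : R) (h : R -> R) (eps : R)
    (s_gt0 : 0 < s) (s_lt1 : s < 1) (h_C2 : classC 2 [set: R] h)
    (eps_gt0 : 0 < eps) (eps_lt1 : eps < 1) :
  exists (d1 d2 : R) (v : R -> R),
    [/\ 0 <= d1 <= eps / 2,
        0 <= d2 <= eps / 2,
        classC 2 `](- 1 - eps), (1 + eps)[ v &
        continuous v] /\
    (normC 2 `](- 1)%R, 1%R[ (fun x => (v x - h x)%R) <= eps%:E)%E /\
    (forall x, - 1 - d1 < x < 1 + d2 -> frac_laplacian_eq s v x 0) /\
    (forall x, x = - 1 - d1 \/ x = 1 + d2 ->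
       frac_normal_derivative_eq s `](- 1 - d1), (1 + d2)[ v x 0) /\
    (v^`()%classic (- 1 - d1) = 0 /\ v^`()%classic (1 + d2) = 0) /\
    bounded_support v.
Proof.
have h_data a b : C2_data a b h h^`(1)%classic h^`(2)%classic.
  move=> x _; have [dx cx] := h_C2 x I; split; last exact: (cx 2%N).
  - by split; [exact: (dx 0%N)|rewrite derive1n1 derive1E].
  - by split; [exact: (dx 1%N)|rewrite (derive1nS h 1) derive1E].
pose d := eps / 4; have dE : d = eps / 4 by [].
have d0 : 0 < d by lra.
have [g [g1 [g2 [g_data gh r1 r2 [l1 l2]]]]] := turning_points _ _ _ d d0 h_data.
have dg (x : R) : -2 < x < 2 -> is_derive x 1 g (g1 x) by move=> /(g_data (-2) 2)[].
have dg1 (x : R) : -2 < x < 2 -> is_derive x 1 g1 (g2 x) by move=> /(g_data (-2) 2)[].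
have cg2 : continuous g2.
  by move=> x; have /(g_data (x - 1) (x + 1))[_ _] : x - 1 < x < x + 1 by apply/andP; split; lra.
have e3 : 0 < eps / 3 by lra.
have [v [v1 [v2 [v_data gv cv sv Lv]]]] :=
  locally_harmonic_density s g g1 g2 _ s_gt0 s_lt1 e3 dg dg1 cg2.
have cv1 x : -2 < x < 2 -> {for x, continuous v1}.
  by move=> /v_data[_ d1 _]; exact: is_derive_continuous d1.
(* Where g has slope -1 or 1 the slope of v has the same sign, so v' vanishes in between. *)
have zero a b : -2 < a -> a <= b -> b < 2 -> v1 a * v1 b <= 0 -> exists2 c, a <= c <= b & v1 c = 0.
  move=> a2 ab b2 vab.
  have [||c] := @IVT R v1 a b 0 ab.
  - apply: continuous_in_subspaceT => x; rewrite inE/= in_itv/= => /andP[ax xb].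
    by apply: cv1; apply/andP; split; lra.
  - rewrite ge_min le_max; apply/andP; split.
      by have [//|a0] := leP (v1 a) 0; rewrite /= -(pmulr_rle0 _ a0).
    by have [//|a0] := leP 0 (v1 a); rewrite /= -(nmulr_rle0 _ a0).
  by rewrite in_itv/= => cab vc; exists c.
have near1 x y : -2 < x < 2 -> g1 x = y -> y - eps / 3 <= v1 x <= y + eps / 3.
  move=> hx gx; have [_ + _] := gv x hx; rewrite gx ler_norml.
  by move=> /andP[h1 h2]; apply/andP; split; lra.
have [cr /andP[cr1 cr2] vr] : exists2 c, 1 + d <= c <= 1 + 2 * d & v1 c = 0.
  apply: zero; [lra|lra|lra|].
  have /andP[_ n1] : -1 - eps / 3 <= v1 (1 + d) <= -1 + eps / 3.
    by apply: near1 => //; apply/andP; split; lra.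
  have /andP[n2 _] : 1 - eps / 3 <= v1 (1 + 2 * d) <= 1 + eps / 3.
    by apply: near1 => //; apply/andP; split; lra.
  by rewrite mulr_le0_ge0//; lra.
have [cl /andP[cl1 cl2] vl] : exists2 c, - 1 - 2 * d <= c <= - 1 - d & v1 c = 0.
  apply: zero; [lra|lra|lra|].
  have /andP[_ n1] : -1 - eps / 3 <= v1 (- 1 - d) <= -1 + eps / 3.
    by apply: near1 => //; apply/andP; split; lra.
  have /andP[n2 _] : 1 - eps / 3 <= v1 (- 1 - 2 * d) <= 1 + eps / 3.
    by apply: near1 => //; apply/andP; split; lra.
  by rewrite mulr_ge0_le0//; lra.
have vE x : -2 < x < 2 -> v^`()%classic x = v1 x.
  by move=> /(C2_data_derive _ _ _ _ _ _ v_data)[+ _ _ _]; rewrite derive1n1.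
have El : - 1 - (- 1 - cl) = cl by ring.
have Er : 1 + (cr - 1) = cr by ring.
exists (- 1 - cl), (cr - 1), v; rewrite El Er; split; [|split; [|split; [|split; [|split]]]].
- split; [by apply/andP; split; lra|by apply/andP; split; lra| |exact: cv].
  move=> x /=; rewrite in_itv/= => /andP[x1 x2].
  have hx : -2 < x < 2 by apply/andP; split; lra.
  by have [_ _ H1 H2] := C2_data_derive _ _ _ _ _ _ v_data hx.
- have u_data : C2_data (-1) 1 (fun x => v x - h x)
      (fun x => v1 x - h^`(1)%classic x) (fun x => v2 x - h^`(2)%classic x).
    have m2 : -2 <= -1 :> R by lra.
    have p2 : 1 <= 2 :> R by lra.
    have := C2_dataD _ _ _ _ _ _ _ _ (C2_dataW _ _ _ _ _ _ _ m2 p2 v_data)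
      (C2_dataZ _ _ (-1) _ _ _ (h_data (-1) 1)).
    congr C2_data; apply/funext => x; by rewrite mulN1r.
  apply: normC2_le u_data _ => x hx.
  have hx2 : -2 < x < 2 by case/andP: hx => x1 x2; apply/andP; clear - x1 x2; split; lra.
  have hx1 : -1 <= x <= 1 by case/andP: hx => x1 x2; rewrite !ltW.
  have [b0 b1 b2] := gv x hx2; have [E0 E1 E2] := gh x hx1.
  by rewrite distrC -E0 (distrC (v1 x)) -E1 (distrC (v2 x)) -E2.
- by move=> x /andP[x1 x2]; apply: Lv; apply/andP; split; lra.
- have hv (y : R) : -2 < y < 2 -> is_derive y 1 v (v1 y) by move=> /v_data[].
  move=> x [->|->]; (apply: (@frac_normal_derivative_eq0 R s _ v v1 _ (-2) 2) => //;
    [|apply: cv1]; apply/andP; split; lra).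
- by split; rewrite vE//; apply/andP; split; lra.
- exact: sv.
Qed.
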